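(* Let $n\ge1$ and let $a_i,b_i\in\mathbb C$ with $a_i-b_i\in\mathbb Z_{>0}$ for $1\le i\le n$. Suppose that for any $1\le i<j\le n$ the set $S(a_i,b_i)\cup S(a_j,b_j)$ is not a string. Then for every $x\in Z$ the action of the algebra $\mathcal B(x)$ on the $\mathrm Y(\mathfrak{gl}_2)$-module $L(a_1,b_1)\otimes\cdots\otimes L(a_n,b_n)$ has a cyclic vector (a vector $v$ such that $\mathcal B(x)v$ is the whole module).
   Context: **Yangian.** $\mathrm Y(\mathfrak{gl}_2)$ is the associative unital $\mathbb C$-algebra generated by $t_{ij}^{(r)}$, $1\le i,j\le 2$, $r\ge 0$, $t_{ij}^{(0)}=\delta_{ij}$, with relations $[t_{ij}^{(r+1)},t_{kl}^{(s)}]-[t_{ij}^{(r)},t_{kl}^{(s+1)}]=t_{kj}^{(r)}t_{il}^{(s)}-t_{kj}^{(s)}t_{il}^{(r)}$. Put $t_{ij}(u)=\sum_{r\ge0}t_{ij}^{(r)}u^{-r}$, $T(u)=(t_{ij}(u))_{i,j}$. The comultiplication is $\Delta(t_{ij}(u))=\sum_{k=1}^2t_{ik}(u)\otimes t_{kj}(u)$; it defines the action on tensor products. **Modules.** $L(a,b)$, for $a-b\in\mathbb Z_{>0}$, is the finite-dimensional irreducible $\mathfrak{gl}_2$-module of highest weight $(a,b)$, regarded as a $\mathrm Y(\mathfrak{gl}_2)$-module via the evaluation homomorphism $t_{ij}(u)\mapsto\delta_{ij}+E_{ij}u^{-1}\in U(\mathfrak{gl}_2)[u^{-1}]$. **Strings.**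 A string is a set of the form $S(a,b)=\{a-1,a-2,\ldots,b+1,b\}$ with $a,b\in\mathbb C$, $a-b\in\mathbb Z_{>0}$. **Bethe subalgebras.** For $C=(c_{ij})\in \mathrm{Mat}_2(\mathbb C)$, $B(C)$ is the commutative subalgebra generated by all coefficients of $\operatorname{qdet}T(u)=t_{11}(u)t_{22}(u-1)-t_{21}(u)t_{12}(u-1)$ and of $\operatorname{tr}CT(u)=c_{11}t_{11}(u)+c_{12}t_{21}(u)+c_{21}t_{12}(u)+c_{22}t_{22}(u)$; it depends only on $[C]\in\mathbb P(\mathrm{Mat}_2)=\mathbb{CP}^3$. **The family $\mathcal B$.** $Z$ is the blow-up of $\mathbb{CP}^3$ at $[I]$, $I$ the identity matrix; $\mathcal B$ is the closure over $Z$ of the family $[C]\mapsto B(C)$, $[C]\ne[I]$. Explicitly: if $x\in Z$ lies over $[C]\neq[I]$, then $\mathcal B(x)=B(C)$; if $x$ lies on the exceptional divisor $\mathbb{CP}^2$, with homogeneous coordinates $[y_0:y_1:y_2]$ (limits of $[x_{11}-x_{22}:x_{12}:x_{21}]$), then $\mathcal B(x)$ is generated by $B(I)$ and $\tfrac12y_0t_{11}^{(1)}+y_1t_{21}^{(1)}+y_2t_{12}^{(1)}-\tfrac12y_0t_{22}^{(1)}$. Thus as $x$ varies over the exceptional divisor this last element runs over all nonzero elements, up to scale, of $\langle t_{12}^{(1)},t_{21}^{(1)},t_{11}^{(1)}-t_{22}^{(1)}\rangle\simeq\mathfrak{sl}_2$. *)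

(* Defs.v *)
From HB Require Import structures.
From mathcomp Require Import all_boot all_order all_algebra.
From mathcomp Require Import mxtens complex generic_quotient.
From mathcomp Require Import mathcomp_extra boolp classical_sets reals.

Set Implicit Arguments.
Unset Strict Implicit.
Unset Printing Implicit Defensive.
Import Order.TTheory GRing.Theory Num.Theory.
Local Open Scope quotient_scope.
Local Open Scope classical_set_scope.
Local Open Scope ring_scope.

(* Indices run over 'I_2 = {0, 1} instead of {1, 2} throughout.  [t i j r] is
   the coefficient of u^-r in t_ij(u). *)
Definition yangian_rel (R : pzRingType) (t : 'I_2 -> 'I_2 -> nat -> R) : Prop :=
  (forall i j, t i j 0%N = (i == j)%:R) /\
  (forall i j k l r s,
     (t i j r.+1 * t k l s - t k l s * t i j r.+1)
     - (t i j r * t k l s.+1 - t k l s.+1 * t i j r)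
     = t k j r * t i l s - t k j s * t i l r).

(* The Yangian is the quotient of the formal algebra expressions in the
   generators by the congruence generated by the axioms of a unital
   associative algebra and the defining relations. *)
Inductive yterm (K : Type) : Type :=
| YConst of K
| YGen of 'I_2 & 'I_2 & nat
| YAdd of yterm K & yterm K
| YMul of yterm K & yterm K.

Arguments YGen {K}.

HB.instance Definition _ (K : Type) := gen_eqMixin (yterm K).
HB.instance Definition _ (K : Type) := gen_choiceMixin (yterm K).

Section Yangian.
Variable K : fieldType.
Local Notation term := (yterm K).

Definition ysub (a b : term) : term := YAdd a (YMul (YConst (-1)) b).
Definition ycomm (a b : term) : term := ysub (YMul a b) (YMul b a).

Inductive yequiv : term -> term -> Prop :=
| yequiv_refl a : yequiv a a
| yequiv_sym a b : yequiv a b -> yequiv b a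
| yequiv_trans a b c : yequiv a b -> yequiv b c -> yequiv a c
| yequiv_add a a' b b' :
    yequiv a a' -> yequiv b b' -> yequiv (YAdd a b) (YAdd a' b')
| yequiv_mul a a' b b' :
    yequiv a a' -> yequiv b b' -> yequiv (YMul a b) (YMul a' b')
| yequiv_addA a b c : yequiv (YAdd a (YAdd b c)) (YAdd (YAdd a b) c)
| yequiv_addC a b : yequiv (YAdd a b) (YAdd b a)
| yequiv_add0 a : yequiv (YAdd (YConst 0) a) a
| yequiv_mulA a b c : yequiv (YMul a (YMul b c)) (YMul (YMul a b) c)
| yequiv_mul1 a : yequiv (YMul (YConst 1) a) a
| yequiv_mul0 a : yequiv (YMul (YConst 0) a) (YConst 0)
| yequiv_mulDl a b c :
    yequiv (YMul (YAdd a b) c) (YAdd (YMul a c) (YMul b c))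
| yequiv_mulDr a b c :
    yequiv (YMul a (YAdd b c)) (YAdd (YMul a b) (YMul a c))
| yequiv_constD x y : yequiv (YConst (x + y)) (YAdd (YConst x) (YConst y))
| yequiv_constM x y : yequiv (YConst (x * y)) (YMul (YConst x) (YConst y))
| yequiv_constC x a : yequiv (YMul (YConst x) a) (YMul a (YConst x))
| yequiv_gen0 i j : yequiv (YGen i j 0) (YConst (i == j)%:R)
| yequiv_rel i j k l r s :
    yequiv (ysub (ycomm (YGen i j r.+1) (YGen k l s))
                 (ycomm (YGen i j r) (YGen k l s.+1)))
           (ysub (YMul (YGen k j r) (YGen i l s))
                 (YMul (YGen k j s) (YGen i l r))).

Definition yequivb (a b : term) : bool := `[< yequiv a b >].

Lemma yequivb_refl : reflexive yequivb.
Proof. by move=> a; apply/asboolP; exact: yequiv_refl. Qed.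

Lemma yequivb_sym : symmetric yequivb.
Proof.
by move=> a b; apply/asboolP/asboolP => h; exact: yequiv_sym.
Qed.

Lemma yequivb_trans : transitive yequivb.
Proof.
move=> b a c /asboolP ab /asboolP bc; apply/asboolP.
exact: yequiv_trans ab bc.
Qed.

Canonical yequiv_equiv :=
  EquivRel yequivb yequivb_refl yequivb_sym yequivb_trans.

Definition yangian := {eq_quot yequiv_equiv}.
HB.instance Definition _ := Choice.on yangian.
HB.instance Definition _ : EqQuotient _ yequiv_equiv yangian :=
  EqQuotient.on yangian.

Lemma ypiP (a b : term) : (\pi_yangian a = \pi_yangian b) <-> yequiv a b.
Proof. by split=> [/eqmodP/asboolP|h] //; apply/eqmodP/asboolP. Qed.

Lemma yreprP (a : term) : yequiv (repr (\pi_yangian a)) a.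
Proof. by apply/ypiP; rewrite reprK. Qed.

Definition yconst (c : K) : yangian := \pi_yangian (YConst c).
Definition yadd (x y : yangian) : yangian := \pi_yangian (YAdd (repr x) (repr y)).
Definition ymul (x y : yangian) : yangian := \pi_yangian (YMul (repr x) (repr y)).
Definition yopp (x : yangian) : yangian := ymul (yconst (-1)) x.

Lemma yaddE a b : yadd (\pi_yangian a) (\pi_yangian b) = \pi_yangian (YAdd a b).
Proof. by apply/ypiP/yequiv_add; exact: yreprP. Qed.

Lemma ymulE a b : ymul (\pi_yangian a) (\pi_yangian b) = \pi_yangian (YMul a b).
Proof. by apply/ypiP/yequiv_mul; exact: yreprP. Qed.

Lemma yind (P : yangian -> Prop) : (forall a : term, P (\pi_yangian a)) -> forall x, P x.
Proof. by move=> h x; rewrite -[x]reprK. Qed.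

Lemma yaddA : associative yadd.
Proof.
elim/yind=> a; elim/yind=> b; elim/yind=> c.
by rewrite !yaddE; apply/ypiP/yequiv_addA.
Qed.

Lemma yaddC : commutative yadd.
Proof.
by elim/yind=> a; elim/yind=> b; rewrite !yaddE; apply/ypiP/yequiv_addC.
Qed.

Lemma yadd0 : left_id (yconst 0) yadd.
Proof. by elim/yind=> a; rewrite !yaddE; apply/ypiP/yequiv_add0. Qed.

Lemma ymulA : associative ymul.
Proof.
elim/yind=> a; elim/yind=> b; elim/yind=> c.
by rewrite !ymulE; apply/ypiP/yequiv_mulA.
Qed.

Lemma ymul1l : left_id (yconst 1) ymul.
Proof. by elim/yind=> a; rewrite !ymulE; apply/ypiP/yequiv_mul1. Qed.

Lemma yconstC c x : ymul (yconst c) x = ymul x (yconst c).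
Proof. by elim/yind: x => a; rewrite !ymulE; apply/ypiP/yequiv_constC. Qed.

Lemma ymul1r : right_id (yconst 1) ymul.
Proof. by move=> x; rewrite -yconstC ymul1l. Qed.

Lemma ymulDl : left_distributive ymul yadd.
Proof.
elim/yind=> a; elim/yind=> b; elim/yind=> c.
by rewrite !(ymulE, yaddE); apply/ypiP/yequiv_mulDl.
Qed.

Lemma ymulDr : right_distributive ymul yadd.
Proof.
elim/yind=> a; elim/yind=> b; elim/yind=> c.
by rewrite !(ymulE, yaddE); apply/ypiP/yequiv_mulDr.
Qed.

Lemma yconstD x y : yconst (x + y) = yadd (yconst x) (yconst y).
Proof. by rewrite yaddE; apply/ypiP/yequiv_constD. Qed.

Lemma yconstM x y : yconst (x * y) = ymul (yconst x) (yconst y).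
Proof. by rewrite ymulE; apply/ypiP/yequiv_constM. Qed.

Lemma yaddN : left_inverse (yconst 0) yopp yadd.
Proof.
move=> x; rewrite /yopp -{2}[x]ymul1l -ymulDl -yconstD addNr.
by elim/yind: x => a; rewrite !ymulE; apply/ypiP/yequiv_mul0.
Qed.

HB.instance Definition _ :=
  GRing.isZmodule.Build yangian yaddA yaddC yadd0 yaddN.
HB.instance Definition _ :=
  GRing.Zmodule_isPzRing.Build yangian ymulA ymul1l ymul1r ymulDl ymulDr.

Section Eval.
Variables (d : nat) (T : 'I_2 -> 'I_2 -> nat -> 'M[K]_d).

Fixpoint yeval_term (a : term) : 'M[K]_d :=
  match a with
  | YConst c => c%:M
  | YGen i j r => T i j r
  | YAdd a b => yeval_term a + yeval_term b
  | YMul a b => yeval_term a * yeval_term b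
  end.

Lemma yeval_equiv (hT : yangian_rel T) (a b : term) :
  yequiv a b -> yeval_term a = yeval_term b.
Proof.
have m1 (x : 'M[K]_d) : (- 1 : K)%:M * x = - x.
  by rewrite rmorphN rmorph1 mulN1r.
elim=> //=.
- by move=> {}a b' c _ -> _ ->.
- by move=> a1 a2 b1 b2 _ -> _ ->.
- by move=> a1 a2 b1 b2 _ -> _ ->.
- by move=> *; rewrite addrA.
- by move=> *; rewrite addrC.
- by move=> *; rewrite rmorph0 add0r.
- by move=> *; rewrite mulrA.
- by move=> *; rewrite rmorph1 mul1r.
- by move=> *; rewrite rmorph0 mul0r.
- by move=> *; rewrite mulrDl.
- by move=> *; rewrite mulrDr.
- by move=> *; rewrite rmorphD.
- by move=> *; rewrite rmorphM.
- by move=> x c; rewrite -!mulmxE scalar_mxC.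
- by move=> i j; rewrite hT.1 rmorph_nat.
- by move=> i j k l r s; rewrite !m1; exact: hT.2.
Qed.

Definition yeval of yangian_rel T := fun y : yangian => yeval_term (repr y).

Hypothesis hT : yangian_rel T.

Lemma yevalE a : yeval hT (\pi_yangian a) = yeval_term a.
Proof. by apply: yeval_equiv => //; exact: yreprP. Qed.
End Eval.

Lemma yangian_oner_neq0 : (1 : yangian) != 0.
Proof.
pose T (i j : 'I_2) (r : nat) : 'M[K]_1 := ((i == j) && (r == 0%N))%:R.
have hT : yangian_rel T.
  split=> [i j|i j k l r s]; first by rewrite /T eqxx andbT.
  rewrite /T -!natrM !(mulnC ((k == l) && _)) !subrr !natrM.
  by case: r s => [|r] [|s]; rewrite /= ?andbF ?mulr0 ?mul0r ?subrr.
apply/eqP => /(congr1 (yeval hT)); rewrite !yevalE /= => /eqP.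
by rewrite rmorph1 rmorph0 oner_eq0.
Qed.

HB.instance Definition _ :=
  GRing.PzSemiRing_isNonZero.Build yangian yangian_oner_neq0.

Definition yscale (c : K) (x : yangian) : yangian := yconst c * x.

Lemma yscaleA a b x : yscale a (yscale b x) = yscale (a * b) x.
Proof. by rewrite /yscale mulrA yconstM. Qed.

Lemma yscale1 : left_id 1 yscale.
Proof. exact: mul1r. Qed.

Lemma yscaleDr : right_distributive yscale +%R.
Proof. by move=> c; exact: mulrDr. Qed.

Lemma yscaleDl x : {morph yscale^~ x : a b / a + b}.
Proof. by move=> a b; rewrite /yscale yconstD mulrDl. Qed.

HB.instance Definition _ := GRing.Zmodule_isLmodule.Build K yangian
  yscaleA yscale1 yscaleDr yscaleDl.

Lemma yscaleAl (c : K) (x y : yangian) : c *: (x * y) = (c *: x) * y.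
Proof. exact: mulrA. Qed.

HB.instance Definition _ := GRing.Lmodule_isLalgebra.Build K yangian yscaleAl.

Lemma yscaleAr (c : K) (x y : yangian) : c *: (x * y) = x * (c *: y).
Proof.
have yC z : yconst c * z = z * yconst c by exact: yconstC.
rewrite -[LHS]/(yconst c * (x * y)) -[c *: y]/(yconst c * y).
by rewrite mulrA yC mulrA.
Qed.

HB.instance Definition _ := GRing.Lalgebra_isAlgebra.Build K yangian yscaleAr.

Definition ygen (i j : 'I_2) (r : nat) : yangian := \pi_yangian (YGen i j r).

Lemma ygen_rel : yangian_rel ygen.
Proof.
have natE (b : bool) : (b%:R : yangian) = \pi_yangian (YConst b%:R) by case: b.
have piB a b : \pi_yangian a - \pi_yangian b = \pi_yangian (ysub a b).
  by rewrite -yaddE -ymulE.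
have piM a b : \pi_yangian a * \pi_yangian b = \pi_yangian (YMul a b).
  exact: ymulE.
have piC a b : \pi_yangian a * \pi_yangian b - \pi_yangian b * \pi_yangian a
    = \pi_yangian (ycomm a b).
  by rewrite !piM piB.
split=> [i j|i j k l r s]; first by rewrite natE; apply/ypiP/yequiv_gen0.
rewrite /ygen (piC (YGen i j r.+1) (YGen k l s)).
rewrite (piC (YGen i j r) (YGen k l s.+1)) piB.
by rewrite !piM piB; apply/ypiP/yequiv_rel.
Qed.

Section Lift.
Variables (d : nat) (T : 'I_2 -> 'I_2 -> nat -> 'M[K]_d).
Hypothesis hT : yangian_rel T.

Lemma yeval_is_zmod_morphism : zmod_morphism (yeval hT).
Proof.
elim/yind=> a; elim/yind=> b.
rewrite -[_ - _]/(yadd _ (ymul _ _)) ymulE yaddE !yevalE /=.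
by rewrite rmorphN rmorph1 mulN1r.
Qed.
HB.instance Definition _ :=
  GRing.isZmodMorphism.Build yangian 'M[K]_d (yeval hT) yeval_is_zmod_morphism.

Lemma yeval_is_monoid_morphism : monoid_morphism (yeval hT).
Proof.
split; first by rewrite yevalE /= rmorph1.
by elim/yind=> a; elim/yind=> b; rewrite -[_ * _]/(ymul _ _) ymulE !yevalE.
Qed.
HB.instance Definition _ :=
  GRing.isMonoidMorphism.Build yangian 'M[K]_d (yeval hT)
    yeval_is_monoid_morphism.

Lemma yeval_is_scalable : scalable (yeval hT).
Proof.
move=> c; elim/yind=> a; rewrite -[_ *: _]/(ymul _ _) ymulE !yevalE /=.
exact: mul_scalar_mx.
Qed.
HB.instance Definition _ :=
  GRing.isScalable.Build K yangian 'M[K]_d *:%R (yeval hT) yeval_is_scalable.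

Lemma yeval_gen i j r : yeval hT (ygen i j r) = T i j r.
Proof. exact: yevalE. Qed.
End Lift.

(* A finite-dimensional module is given on column vectors 'cV_d, the algebra
   acting on the left through d x d matrices. *)
Record ymodule := YModule {
  ydim : nat;
  yact : {lrmorphism yangian -> 'M[K]_ydim} }.

Definition ymodule_of (d : nat) (T : 'I_2 -> 'I_2 -> nat -> 'M[K]_d)
  (hT : yangian_rel T) : ymodule := YModule (yeval hT).

Record gl2module := Gl2Module {
  gdim : nat;
  gE : 'I_2 -> 'I_2 -> 'M[K]_gdim;
  gE_rel : forall i j k l, gE i j *m gE k l - gE k l *m gE i j
    = (j == k)%:R *: gE i l - (i == l)%:R *: gE k j }.

Definition gl2_irreducible (V : gl2module) : Prop :=
  (0 < gdim V)%N /\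
  forall W : {vspace 'cV[K]_(gdim V)},
    (forall i j v, v \in W -> gE V i j *m v \in W) -> W = 0%VS \/ W = fullv.

Definition gl2_highest_weight (V : gl2module) (a b : K) : Prop :=
  exists v : 'cV[K]_(gdim V),
    [/\ v != 0, gE V 0 1 *m v = 0, gE V 0 0 *m v = a *: v
      & gE V 1 1 *m v = b *: v].

(* V is (a copy of) L(a, b). *)
Definition is_L (V : gl2module) (a b : K) : Prop :=
  gl2_irreducible V /\ gl2_highest_weight V a b.

Definition ev_op (V : gl2module) (i j : 'I_2) (r : nat) : 'M[K]_(gdim V) :=
  match r with 0 => (i == j)%:R | 1 => gE V i j | _ => 0 end.

Lemma ev_rel (V : gl2module) : yangian_rel (ev_op V).
Proof.
split=> // i j k l r s.
have cE (b : bool) (x : 'M[K]_(gdim V)) : x * b%:R = b%:R * x.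
  by rewrite mulr_natl mulr_natr.
have cEE : gE V i j * gE V k l - gE V k l * gE V i j
    = (k == j)%:R * gE V i l - gE V k j * (i == l)%:R.
  rewrite -!mulmxE gE_rel !mulmxE cE [k == j]eq_sym.
  by rewrite !scaler_nat !mulr_natl.
case: r s => [|[|r]] [|[|s]] /=;
  rewrite ?mulr0 ?mul0r ?subrr ?subr0 ?sub0r ?mulr0 ?mul0r ?subrr ?oppr0 //.
- by rewrite [gE V i j * _]cE [gE V k l * _]cE !subrr.
- by rewrite cEE opprB.
Qed.

Definition ev_module (V : gl2module) : ymodule := ymodule_of (ev_rel V).

End Yangian.

Section Coproduct.
Variable R : pzRingType.
Implicit Types (F G : nat -> nat -> R) (A B : 'I_2 -> 'I_2 -> nat -> R).

Let conv F G r s := \sum_(p < r.+1) \sum_(q < s.+1) F p q * G (r - p)%N (s - q)%N.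
Let delta F r s := F r.+1 s - F r s.+1.

Lemma delta_convl F G r s :
  (forall q, F 0%N q = 0) -> (forall p, F p 0%N = 0) ->
  delta (conv F G) r s = conv (delta F) G r s.
Proof.
move=> F0l F0r; rewrite /delta /conv big_ord_recl /=.
rewrite big1 ?add0r => [|q _]; last by rewrite F0l mul0r.
rewrite -sumrB; apply: eq_bigr => p _.
rewrite [X in _ - X]big_ord_recl /= F0r mul0r add0r -sumrB.
by apply: eq_bigr => q _; rewrite /bump /= !add1n !subSS mulrBl.
Qed.

Lemma conv_rev F G r s :
  conv F G r s
  = \sum_(p < r.+1) \sum_(q < s.+1) F (r - p)%N (s - q)%N * G p q.
Proof.
rewrite /conv (reindex_inj rev_ord_inj); apply: eq_bigr => p _ /=.
rewrite (reindex_inj rev_ord_inj); apply: eq_bigr => q _ /=.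
by rewrite !subSS !subKn // -ltnS.
Qed.

Lemma delta_convr F G r s :
  (forall q, G 0%N q = 0) -> (forall p, G p 0%N = 0) ->
  delta (conv F G) r s = conv F (delta G) r s.
Proof.
move=> G0l G0r; rewrite /delta !conv_rev big_ord_recl /=.
rewrite big1 ?add0r => [|q _]; last by rewrite G0l mulr0.
rewrite -sumrB; apply: eq_bigr => p _.
rewrite [X in _ - X]big_ord_recl /= G0r mulr0 add0r -sumrB.
by apply: eq_bigr => q _; rewrite /bump /= !add1n !subSS mulrBr.
Qed.

Definition coprod A B (i j : 'I_2) (r : nat) : R :=
  \sum_(k < 2) \sum_(p < r.+1) A i k p * B k j (r - p)%N.

Lemma coprodM A B (hAB : forall i j p k l q, A i j p * B k l q = B k l q * A i j p)
    i j k l r s :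
  coprod A B i j r * coprod A B k l s =
  \sum_(m < 2) \sum_(n < 2)
    conv (fun p q => A i m p * A k n q) (fun p q => B m j p * B n l q) r s.
Proof.
rewrite /coprod /conv mulr_suml; apply: eq_bigr => m _.
rewrite mulr_sumr; apply: eq_bigr => n _.
rewrite mulr_suml; apply: eq_bigr => p _.
rewrite mulr_sumr; apply: eq_bigr => q _.
by rewrite !mulrA; congr (_ * _); rewrite -!mulrA hAB.
Qed.

Lemma coprodM' A B (hAB : forall i j p k l q, A i j p * B k l q = B k l q * A i j p)
    i j k l r s :
  coprod A B k l s * coprod A B i j r =
  \sum_(m < 2) \sum_(n < 2)
    conv (fun p q => A k n q * A i m p) (fun p q => B n l q * B m j p) r s.
Proof.
rewrite coprodM // exchange_big; apply: eq_bigr => m _; apply: eq_bigr => n _.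
by rewrite /conv exchange_big.
Qed.

Lemma coprod_rel A B :
  (forall i j p k l q, A i j p * B k l q = B k l q * A i j p) ->
  yangian_rel A -> yangian_rel B -> yangian_rel (coprod A B).
Proof.
move=> hAB [A0 hA] [B0 hB]; split=> [i j|i j k l r s].
  rewrite /coprod; under eq_bigr do rewrite big_ord1 subnn A0 B0 -natrM mulnb.
  case: (eqVneq i j) => [<-|ij].
    rewrite (bigD1 i) //= eqxx big1 ?addr0 // => k ki.
    by rewrite eq_sym (negPf ki).
  by rewrite big1 // => k _; case: eqP => // <-; rewrite (negPf ij).
pose F1 m n p q := A i m p * A k n q; pose F2 m n p q := A k n q * A i m p.
pose G1 m n p q := B m j p * B n l q; pose G2 m n p q := B n l q * B m j p.
pose F m n p q := F1 m n p q - F2 m n p q.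
pose G m n p q := G1 m n p q - G2 m n p q.
have comm0 (b : bool) (x : R) : b%:R * x - x * b%:R = 0.
  by rewrite mulr_natl mulr_natr subrr.
have F0l m n q : F m n 0%N q = 0 by rewrite /F /F1 /F2 A0 comm0.
have F0r m n p : F m n p 0%N = 0.
  by rewrite /F /F1 /F2 A0 -opprB comm0 oppr0.
have G0l m n q : G m n 0%N q = 0 by rewrite /G /G1 /G2 B0 comm0.
have G0r m n p : G m n p 0%N = 0.
  by rewrite /G /G1 /G2 B0 -opprB comm0 oppr0.
have commE r' s' : coprod A B i j r' * coprod A B k l s'
    - coprod A B k l s' * coprod A B i j r' =
    \sum_(m < 2) \sum_(n < 2)
      (conv (F m n) (G1 m n) r' s' + conv (F2 m n) (G m n) r' s').
  rewrite coprodM // coprodM' // -sumrB; apply: eq_bigr => m _.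
  rewrite -sumrB; apply: eq_bigr => n _.
  rewrite /conv -sumrB -big_split; apply: eq_bigr => p _.
  rewrite -sumrB -big_split; apply: eq_bigr => q _ /=.
  by rewrite /F /G mulrBl mulrBr addrA subrK.
rewrite !commE -sumrB.
pose H m n p q := A k m p * A i n q - A k m q * A i n p.
pose L m n p q := B n j p * B m l q - B n j q * B m l p.
transitivity (\sum_(m < 2) \sum_(n < 2)
    (conv (H m n) (G1 m n) r s + conv (F2 m n) (L m n) r s)).
  apply: eq_bigr => m _; rewrite -sumrB; apply: eq_bigr => n _.
  rewrite opprD addrACA.
  congr (_ + _).
    rewrite -[LHS]/(delta (conv _ _) _ _) delta_convl //.
    by apply: eq_bigr => p _; apply: eq_bigr => q _; rewrite /delta hA.
  rewrite -[LHS]/(delta (conv _ _) _ _) delta_convr //.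
  by apply: eq_bigr => p _; apply: eq_bigr => q _; rewrite /delta hB.
rewrite coprodM // coprodM' //.
pose P1 m n p q := A k m p * A i n q; pose P2 m n p q := A k m q * A i n p.
pose Q m n p q := B n j p * B m l q.
transitivity (\sum_(m < 2) \sum_(n < 2)
  ((conv (P1 m n) (G1 m n) r s - conv (F2 m n) (fun p q => B n j q * B m l p) r s)
   + (conv (F2 m n) (Q m n) r s - conv (P2 m n) (G1 m n) r s))).
  apply: eq_bigr => m _; apply: eq_bigr => n _.
  rewrite /conv -!sumrB -!big_split; apply: eq_bigr => p _ /=.
  rewrite -!sumrB -!big_split; apply: eq_bigr => q _ /=.
  rewrite /H /L /P1 /P2 /Q mulrBl mulrBr.
  by rewrite addrACA [RHS]addrACA [- _ - _]addrC.
transitivity (\sum_(m < 2) \sum_(n < 2) (conv (P1 m n) (G1 m n) r s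
    - conv (F2 m n) (fun p q => B n j q * B m l p) r s)
  + (\sum_(m < 2) \sum_(n < 2) conv (F2 m n) (Q m n) r s
     - \sum_(m < 2) \sum_(n < 2) conv (P2 m n) (G1 m n) r s)).
  rewrite -sumrB -big_split; apply: eq_bigr => m _ /=.
  by rewrite -sumrB -big_split.
rewrite [X in _ + (X - _)]exchange_big subrr addr0 -sumrB.
by apply: eq_bigr => m _; rewrite -sumrB.
Qed.
End Coproduct.

Section Bethe.
Variable K : fieldType.

(* Delta(t_ij(u)) = \sum_k t_ik(u) (x) t_kj(u), coefficient of u^-r. *)
Definition tens_op (M N : ymodule K) (i j : 'I_2) (r : nat) :
    'M[K]_(ydim M * ydim N) :=
  \sum_(k < 2) \sum_(p < r.+1)
    yact M (ygen K i k p) *t yact N (ygen K k j (r - p)).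

Lemma tens_rel (M N : ymodule K) : yangian_rel (tens_op M N).
Proof.
pose A i j r : 'M[K]_(ydim M * ydim N) := yact M (ygen K i j r) *t 1%:M.
pose B i j r : 'M[K]_(ydim M * ydim N) := 1%:M *t yact N (ygen K i j r).
have tens1 m n (b : bool) : b%:R%:M *t 1%:M = b%:R%:M :> 'M[K]_(m * n).
  case: b; last by rewrite !rmorph0 tens0mx.
  apply/matrixP => i j; case: (mxtens_indexP i) => i0 i1.
  case: (mxtens_indexP j) => j0 j1; rewrite tensmxE !mxE.
  by rewrite (can_eq (@mxtens_indexK _ _)) xpair_eqE !mulr1n -natrM mulnb.
have tens1' m n (b : bool) : 1%:M *t b%:R%:M = b%:R%:M :> 'M[K]_(m * n).
  by case: b; rewrite ?(tens1 _ _ true) // !rmorph0 tensmx0.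
have [h0 h] := ygen_rel K.
have act0 (L : ymodule K) i j : yact L (ygen K i j 0) = (i == j)%:R%:M.
  by rewrite h0 !rmorph_nat.
have -> : tens_op M N = coprod A B.
  apply/funext => i; apply/funext => j; apply/funext => r.
  apply: eq_bigr => k _; apply: eq_bigr => p _.
  by rewrite -mulmxE tensmx_mul mulmx1 mul1mx.
apply: coprod_rel.
- by move=> i j p k l q; rewrite -!mulmxE !tensmx_mul !mulmx1 !mul1mx.
- split=> [i j|i j k l r s]; first by rewrite /A act0 tens1 rmorph_nat.
  rewrite /A -!mulmxE !tensmx_mul !mulmx1 !mulmxE -!rmorphM.
  have BE X Y : X *t 1%:M - Y *t 1%:M = (X - Y) *t 1%:M :> 'M[K]_(ydim M * ydim N).
    by apply/matrixP => u v; rewrite !mxE mulrBl.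
  by rewrite !BE -!rmorphB h.
split=> [i j|i j k l r s]; first by rewrite /B act0 tens1' rmorph_nat.
rewrite /B -!mulmxE !tensmx_mul !mulmx1 !mulmxE -!rmorphM.
have BE X Y : 1%:M *t X - 1%:M *t Y = 1%:M *t (X - Y) :> 'M[K]_(ydim M * ydim N).
  by apply/matrixP => u v; rewrite !mxE mulrBr.
by rewrite !BE -!rmorphB h.
Qed.

Definition tens_module (M N : ymodule K) : ymodule K :=
  ymodule_of (tens_rel M N).

Fixpoint tens_family (n : nat) : ('I_n.+1 -> ymodule K) -> ymodule K :=
  match n with
  | 0 => fun M => M ord0
  | n'.+1 => fun M =>
      tens_module (M ord0) (tens_family (fun i => M (lift ord0 i)))
  end.

Definition subalg (S : set (yangian K)) : set (yangian K) :=
  smallest [set A : set (yangian K) | GRing.subalg_closed (mem A)] S.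

(* (u - 1)^-s = \sum_(r >= s) 'C(r - 1, r - s) u^-r, including s = 0 since
   'C(r - 1, r) = 0 for r > 0 and r.-1 = 0 for r = 0. *)
Definition shift1 (t : nat -> yangian K) (r : nat) : yangian K :=
  \sum_(s < r.+1) t s *+ 'C(r.-1, r - s).

Definition series_mul (f g : nat -> yangian K) (r : nat) : yangian K :=
  \sum_(p < r.+1) f p * g (r - p)%N.

Definition qdet (r : nat) : yangian K :=
  series_mul (ygen K 0 0) (shift1 (ygen K 1 1)) r
  - series_mul (ygen K 1 0) (shift1 (ygen K 0 1)) r.

Definition trT (C : 'M[K]_2) (r : nat) : yangian K :=
  C 0 0 *: ygen K 0 0 r + C 0 1 *: ygen K 1 0 r
  + C 1 0 *: ygen K 0 1 r + C 1 1 *: ygen K 1 1 r.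

Definition bethe (C : 'M[K]_2) : set (yangian K) :=
  subalg (range qdet `|` range (trT C)).

(* Homogeneous coordinates in P^2 of the line through [I] and [C] != [I]. *)
Definition offset (C : 'M[K]_2) : 'rV[K]_3 :=
  \row_(j < 3) [:: C 0 0 - C 1 1; C 0 1; C 1 0]`_j.

(* The blow-up of P^3 at [I] is the closure of the graph of the projection
   from [I], i.e. the incidence variety of the pairs ([C], [y]) in P^3 x P^2
   with offset C proportional to y.  A point is given by homogeneous
   coordinates. *)
Record blowup := Blowup {
  bl_mx : 'M[K]_2;
  bl_dir : 'rV[K]_3;
  bl_mx_neq0 : bl_mx != 0;
  bl_dir_neq0 : bl_dir != 0;
  bl_incident : forall i j : 'I_3,
    offset bl_mx 0 i * bl_dir 0 j = offset bl_mx 0 j * bl_dir 0 i }.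

Definition dir_elt (y : 'rV[K]_3) : yangian K :=
  (2^-1 * y 0 0) *: ygen K 0 0 1 + y 0 1 *: ygen K 1 0 1
  + y 0 2 *: ygen K 0 1 1 - (2^-1 * y 0 0) *: ygen K 1 1 1.

Definition bethe_family (x : blowup) : set (yangian K) :=
  if is_scalar_mx (bl_mx x)
  then subalg (bethe 1%:M `|` [set dir_elt (bl_dir x)])
  else bethe (bl_mx x).

Definition has_cyclic_vector (B : set (yangian K)) (M : ymodule K) : Prop :=
  exists v : 'cV[K]_(ydim M), [set yact M y *m v | y in B] = setT.

(* S(a, b) = {a - 1, a - 2, ..., b}, meaningful when a - b is a positive
   integer. *)
Definition string_set (a b : K) : set K :=
  [set z | exists k l : nat, z = b + k%:R /\ z = a - 1 - l%:R].

Definition pos_int (z : K) : Prop := exists m : nat, z = m.+1%:R.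

Definition is_string (A : set K) : Prop :=
  exists a b : K, pos_int (a - b) /\ A = string_set a b.

End Bethe.

(* Main.v *)
Require Import Defs.
From mathcomp Require Import all_boot all_order all_algebra.
From mathcomp Require Import mxtens complex ring.
From mathcomp Require Import boolp classical_sets reals.

(* Write e for the action of t_12^(1) and let A(C) be generated by the
   coefficients of tr C T(u); the quantum determinant is not needed.

   On a tensor product the coefficients of t_12(u) generate everything from the
   product of lowest vectors.  For l_q the weight basis of the first factor
   (from the lowest vector up) and v the lowest vector of the others, t_12(u)
   at u = -(b_1 + q) sends l_q (x) v to prod_j (a_j - b_1 - q) l_(q+1) (x) v, and
   the product is nonzero because no a_j lies in the string of (a_1, b_1); so all
   l_q (x) v are reached, and then l_q (x) w for all w by descending induction
   on q.

   Cyclicity is an open condition, and tr C T(u) with c_21 <> 0 degenerates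
   to t_12(u) under the torus, so A(C) is cyclic when c_21 <> 0.  Conjugation by
   exp(x e) reduces every non-scalar C to this case.

   On the exceptional divisor the same two steps reduce to cyclicity for A(I)
   and e, that is, to cyclicity of A(I) on the cokernel of e.  For C = I + E_21
   the algebra A(C) is cyclic and contains e.  On the cokernel of e its
   generators are those of A(I) plus operators that raise the weight, and the
   Casimir element takes distinct values on the weight spaces of the cokernel.
   The spectral projections of the deformed Casimir element therefore identify
   the cokernel under A(C) with the cokernel under A(I). *)

Set Implicit Arguments.
Unset Strict Implicit.
Unset Printing Implicit Defensive.
Import Order.TTheory GRing.Theory Num.Theory.
Local Open Scope classical_set_scope.
Local Open Scope ring_scope.

(** * Orbits and cyclic families *)

Section Subspaces.
Variables (K : fieldType) (d : nat).
Implicit Types (P : 'cV[K]_d -> Prop) (e : 'M[K]_d).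

(** Predicates rather than [{vspace _}], so that spans defined by induction and their pullbacks
    along linear maps are subspaces directly. *)
Definition subspace P := P 0 /\ forall c x y, P x -> P y -> P (c *: x + y).

Lemma subspaceZ P c x : subspace P -> P x -> P (c *: x).
Proof. by move=> [P0 Pl] Px; rewrite -[_ *: _]addr0; exact: Pl. Qed.

Lemma subspaceD P x y : subspace P -> P x -> P y -> P (x + y).
Proof. by move=> [P0 Pl] Px Py; rewrite -[x]scale1r; exact: Pl. Qed.

Lemma subspaceB P x y : subspace P -> P x -> P y -> P (x - y).
Proof. by move=> [P0 Pl] Px Py; rewrite addrC -scaleN1r; exact: Pl. Qed.

Lemma subspace_sum P (J : Type) (r : seq J) (Q : pred J) F : subspace P ->
  (forall j, Q j -> P (F j)) -> P (\sum_(j <- r | Q j) F j).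
Proof.
move=> Ps h; elim/big_ind: _ => //; first exact: Ps.1.
by move=> x y; exact: subspaceD.
Qed.

Lemma subspaceZ_inv P c x : subspace P -> c != 0 -> P (c *: x) -> P x.
Proof.
by move=> Ps c0 Pc; rewrite -[x](scalerK c0); exact: subspaceZ.
Qed.

Definition image_mod e (x : 'cV[K]_d) : Prop := exists z, x = e *m z.

Lemma subspace_image e : subspace (image_mod e).
Proof.
split=> [|c x y [x' ->] [y' ->]]; first by exists 0; rewrite mulmx0.
by exists (c *: x' + y'); rewrite mulmxDr -scalemxAr.
Qed.

Definition nilpotent e := exists n, forall w : 'cV_d, iter n (mulmx e) w = 0.

Lemma iter_mulmxD e n (x y : 'cV[K]_d) :
  iter n (mulmx e) (x + y) = iter n (mulmx e) x + iter n (mulmx e) y.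
Proof. by elim: n => //= n ->; rewrite mulmxDr. Qed.

(** Nakayama's lemma: decomposing the remainder [z] again and again pushes it into the image of
    [e^k], which is zero for large [k]. *)
Lemma nakayama P e : subspace P -> nilpotent e ->
  (forall w, P w -> P (e *m w)) ->
  (forall w, exists2 u, P u & image_mod e (w - u)) -> forall w, P w.
Proof.
move=> Ps [n en] Pe PD w.
suff h k : exists u z, P u /\ w = u + iter k (mulmx e) z.
  by have [u [z [Pu ->]]] := h n; rewrite en addr0.
elim: k => [|k [u [z [Pu wE]]]].
  by exists 0, w; rewrite add0r; split=> //; exact: Ps.1.
have [u' Pu' [z' zE]] := PD z.
exists (u + iter k (mulmx e) u'), z'; split.
  by apply: subspaceD => //; elim: (k) => //= k' IH; exact: Pe.
by rewrite wE -addrA iterSr -zE -iter_mulmxD [u' + _]addrC subrK.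
Qed.

(** The columns of the cokernel matrix of [e^T], transposed, are functionals whose common kernel is
    the image of [e]. *)
Lemma image_separation e w : ~ image_mod e w ->
  exists2 phi : 'rV[K]_d, phi *m e = 0 & phi *m w != 0.
Proof.
move=> nw; have : w^T *m cokermx e^T != 0.
  apply: contra_notN nw => /eqP h.
  have /submxP [D wE] : (w^T <= e^T)%MS by rewrite submxE h.
  by exists D^T; rewrite -[LHS]trmxK wE trmx_mul trmxK.
move=> /eqP h; have [j hj] : exists j, w^T *m col j (cokermx e^T) != 0.
  apply: contra_notP h => /forallNP h; apply/matrixP => i j.
  have /negP := h j; rewrite negbK colE mulmxA -colE => /eqP/matrixP/(_ i 0).
  by rewrite mxE => ->; rewrite !mxE.
exists (col j (cokermx e^T))^T.
  apply: trmx_inj; rewrite trmx_mul trmxK colE mulmxA mulmx_coker.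
  by rewrite mul0mx trmx0.
by rewrite -trmx_eq0 trmx_mul trmxK.
Qed.
End Subspaces.

Section Orbit.
Variable (K : fieldType) (d : nat).

(** The cyclic submodule generated by [v] under the algebra generated by the [X i], in a form that
    allows induction over its elements. *)
Inductive orbit_span (I : Type) (X : I -> 'M[K]_d) (v : 'cV[K]_d) :
    'cV[K]_d -> Prop :=
| orbit_base : orbit_span X v v
| orbit_lin c x y :
    orbit_span X v x -> orbit_span X v y -> orbit_span X v (c *: x + y)
| orbit_act i x : orbit_span X v x -> orbit_span X v (X i *m x).

Definition cyclic (I : Type) (X : I -> 'M[K]_d) :=
  exists v, forall w, orbit_span X v w.

Variable (I : Type).
Implicit Types (X Y : I -> 'M[K]_d) (v : 'cV[K]_d).

Lemma subspace_orbit X v : subspace (orbit_span X v).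
Proof.
split; last exact: orbit_lin.
by rewrite -[0](addNr v) -scaleN1r; apply: orbit_lin; exact: orbit_base.
Qed.

(** A surjective intertwiner carries a cyclic vector to a cyclic vector. The scalar [c] leaves room
    for the torus, which rescales generators. *)
Lemma cyclic_transport X Y (G : 'M[K]_d) :
  (forall w : 'cV[K]_d, exists z, w = G *m z) ->
  (forall i, exists c, G *m X i = c *: (Y i *m G)) ->
  cyclic X -> cyclic Y.
Proof.
move=> Gs XG [v vX]; exists (G *m v) => w; have [z ->] := Gs w.
elim: (vX z) => [|c x y _ hx _ hy|i x _ hx]; first exact: orbit_base.
  by rewrite mulmxDr -scalemxAr; exact: orbit_lin.
have [c cE] := XG i; rewrite mulmxA cE -scalemxAl -mulmxA.
by apply: subspaceZ; [exact: subspace_orbit | exact: orbit_act].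
Qed.
End Orbit.

Lemma exists_nonroot (K : numFieldType) (p : {poly K}) :
  p != 0 -> exists2 s, s != 0 & p.[s] != 0.
Proof.
move=> p0; pose rs := [seq (k.+1%:R : K) | k <- iota 0 (size p)].
have urs : uniq rs.
  rewrite map_inj_uniq ?iota_uniq // => i j /eqP.
  by rewrite eqr_nat eqSS => /eqP.
have : ~~ all (root p) rs.
  apply/negP => h; have := max_poly_roots p0 h urs.
  by rewrite size_map size_iota ltnn.
by move=> /allPn [_ /mapP [k _ ->]] ?; exists k.+1%:R; rewrite ?pnatr_eq0.
Qed.

Section OpenCyclic.
Variables (K : numFieldType) (d : nat) (I : Type) (X : I -> 'M[{poly K}]_d).
Let at_ (s : K) m n (A : 'M[{poly K}]_(m, n)) := map_mx (horner_eval s) A.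

(** The standard basis, obtained from [v] at parameter 0, lifts to polynomial vectors that lie in
    the orbit of [v] at every [s]. Their determinant is 1 at 0, hence nonzero at some [s != 0],
    where they again span. *)
Lemma cyclic_open : cyclic (fun i => at_ 0 (X i)) ->
  exists2 s, s != 0 & cyclic (fun i => at_ s (X i)).
Proof.
move=> [v vX].
have lift_orbit w : exists p : 'cV[{poly K}]_d, at_ 0 p = w /\
    forall s, orbit_span (fun i => at_ s (X i)) v (at_ s p).
  elim: (vX w) => [|c x y _ [p [<- hp]] _ [q [<- hq]]|i x _ [p [<- hp]]].
  - have vE s : at_ s (map_mx polyC v) = v.
      by apply/matrixP => i j; rewrite !mxE /horner_eval hornerC.
    exists (map_mx polyC v); split=> // s.
    by rewrite vE; exact: orbit_base.
  - have lE s : at_ s (c%:P *: p + q) = c *: at_ s p + at_ s q.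
      by apply/matrixP => i j; rewrite !mxE /horner_eval hornerD hornerM hornerC.
    exists (c%:P *: p + q); split=> // s.
    by rewrite lE; exact: orbit_lin.
  - have mE s : at_ s (X i *m p) = at_ s (X i) *m at_ s p by exact: map_mxM.
    exists (X i *m p); split=> // s.
    by rewrite mE; exact: (orbit_act i (hp s)).
have [b bP] := choice (fun j : 'I_d => lift_orbit (delta_mx j 0)).
have b0 j := (bP j).1; have bs j := (bP j).2.
pose B := \matrix_(i, j) b j i 0.
have colB s j : col j (at_ s B) = at_ s (b j).
  by apply/matrixP => i i'; rewrite !mxE ord1.
have dB0 : (\det B).[0] = 1.
  have -> : (\det B).[0] = \det (at_ 0 B) by rewrite det_map_mx.
  have -> : at_ 0 B = 1%:M; last exact: det1.
  apply/matrixP => i j; have /matrixP /(_ i 0) := b0 j.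
  by rewrite -colB !mxE eqxx andbT => ->.
have [] := @exists_nonroot K (\det B).
  by apply/eqP => h; move: dB0; rewrite h horner0 => /esym/eqP; rewrite oner_eq0.
move=> s s0 ds; exists s => //; exists v => w.
have uB : at_ s B \in unitmx.
  by rewrite unitmxE unitfE det_map_mx.
rewrite -[w](mulKVmx uB); move: (invmx _ *m w) => c.
have -> : at_ s B *m c = \sum_j c j 0 *: col j (at_ s B).
  by apply/colP => i; rewrite summxE !mxE; apply: eq_bigr => j _; rewrite !mxE mulrC.
by apply: subspace_sum => [|j _]; [exact: subspace_orbit
  | apply: subspaceZ; [exact: subspace_orbit | rewrite colB]].
Qed.
End OpenCyclic.

(** * Weight strings *)

Section LinearEntries.
Variables (R : pzRingType) (m n : nat) (A B : 'M[R]_(m, n)).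
Lemma mx_addE i j : (A + B) i j = A i j + B i j. Proof. by rewrite mxE. Qed.
Lemma mx_oppE i j : (- A) i j = - A i j. Proof. by rewrite mxE. Qed.
Lemma mx_scaleE c i j : (c *: A) i j = c * A i j. Proof. by rewrite mxE. Qed.
Lemma mx_zeroE i j : (0 : 'M[R]_(m, n)) i j = 0. Proof. by rewrite mxE. Qed.
End LinearEntries.
Definition mx_linE := (mx_addE, mx_oppE, mx_scaleE, mx_zeroE).

(** Only linear operations are unfolded, so an entry of a matrix product is an atom for [ring]. *)
Ltac mx_lin := apply/matrixP => ? ?; rewrite !mx_linE; ring.

(** Otherwise [d.+1] distinct eigenvalues would be roots of the characteristic polynomial. The
    transpose appears because [eigenvalue] refers to row vectors. *)
Lemma eigen_sequence_vanishes (K : fieldType) (d : nat) (H : 'M[K]_d)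
    (mu : nat -> K) (u : nat -> 'cV[K]_d) :
  injective mu -> (forall k, H *m u k = mu k *: u k) -> exists k, u k = 0.
Proof.
move=> mu_inj Hu; apply: contrapT => /forallNP u0.
pose rs := [seq mu k | k <- iota 0 d.+1].
have urs : uniq rs by rewrite map_inj_uniq ?iota_uniq.
have rrs : all (root (char_poly H^T)) rs.
  apply/allP => _ /mapP [k _ ->]; rewrite -eigenvalue_root_char.
  apply/eigenvalueP; exists (u k)^T; first by rewrite -trmx_mul Hu linearZ.
  by rewrite trmx_eq0; apply/eqP.
have := max_poly_roots (monic_neq0 (char_poly_monic H^T)) rrs urs.
by rewrite size_map size_iota size_char_poly ltnn.
Qed.

Lemma I2P (i : 'I_2) : i = 0 \/ i = 1.
Proof. by case: i => [[|[|//]]] ?; [left | right]; apply/val_inj. Qed.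

Section Sl2.
Variables (K : numFieldType) (d : nat) (E F H : 'M[K]_d).
Hypothesis EF : E *m F - F *m E = H.
Hypothesis HF : H *m F - F *m H = - 2 *: F.
Variables (mu : K) (v : 'cV[K]_d).
Hypotheses (Ev : E *m v = 0) (Hv : H *m v = mu *: v).
Local Notation Fv k := (iter k (mulmx F) v).

Lemma sl2_weight k : H *m Fv k = (mu - 2 * k%:R) *: Fv k.
Proof.
elim: k => [|k IH]; first by rewrite mulr0 subr0.
have HFE : H *m F = F *m H - 2 *: F by rewrite -[LHS](subrK (F *m H)) HF addrC scaleNr.
rewrite /= mulmxA HFE mulmxBl -mulmxA IH -scalemxAr -scalemxAl -scalerBl.
by congr (_ *: _); rewrite -natr1; ring.
Qed.

Lemma sl2_raise k : E *m Fv k.+1 = (k.+1%:R * (mu - k%:R)) *: Fv k.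
Proof.
have EFE : E *m F = F *m E + H by rewrite -EF addrC subrK.
elim: k => [|k IH] /=.
  by rewrite mulmxA EFE mulmxDl -mulmxA Ev mulmx0 add0r Hv subr0 mul1r.
rewrite mulmxA EFE mulmxDl -mulmxA IH -scalemxAr (sl2_weight k.+1) /= -scalerDl.
by congr (_ *: _); rewrite -!natr1; ring.
Qed.

(** The vectors F^k v have distinct weights, so one of them vanishes. If F^(p+1) v is the first,
    applying E to it gives (p+1)(mu - p) F^p v = 0, whence mu = p. *)
Lemma sl2_highest_weight : v != 0 ->
  exists p, [/\ mu = p%:R, Fv p != 0 & Fv p.+1 = 0].
Proof.
move=> v0; have [] := @eigen_sequence_vanishes K d H
  (fun k => mu - 2 * k%:R) (fun k => Fv k).
- move=> i j /addrI/oppr_inj/(mulfI _) /eqP.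
  by rewrite pnatr_eq0 eqr_nat => /(_ isT)/eqP.
- exact: sl2_weight.
move=> k0 Fk0; have ex : exists k, Fv k == 0 by exists k0; apply/eqP.
case: (ex_minnP ex) => [[|p]]; first by rewrite (negPf v0).
move=> /eqP Fp1 minp; exists p.
have Fp : Fv p != 0 by apply/negP => /minp; rewrite ltnn.
split=> //; have /esym/eqP := sl2_raise p.
rewrite Fp1 mulmx0 scaler_eq0 (negPf Fp) orbF mulf_eq0 pnatr_eq0 /=.
by rewrite subr_eq0 => /eqP.
Qed.
End Sl2.

(** The weight basis of L(b + m, b) from the lowest vector up, scaled so that [E 0 1] acts without
    coefficients and continued by zero beyond index [m]. *)
Record lowest_string (K : numFieldType) (d : nat) (E : 'I_2 -> 'I_2 -> 'M[K]_d)
    (b : K) (m : nat) (l : nat -> 'cV[K]_d) : Prop := LowestString {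
  string_E00 : forall q, E 0 0 *m l q = (b + q%:R) *: l q;
  string_E11 : forall q, E 1 1 *m l q = (b + m%:R - q%:R) *: l q;
  string_E01 : forall q, E 0 1 *m l q = l q.+1;
  string_E10_0 : E 1 0 *m l 0%N = 0;
  string_E10 : forall q, E 1 0 *m l q.+1 = (q.+1%:R * (m%:R - q%:R)) *: l q;
  string_end : l m.+1 = 0;
  string_span : forall P, subspace P -> (forall q, P (l q)) -> forall w, P w }.

Lemma gl2_comm (K : fieldType) (V : gl2module K) i j k l :
  gE V i j *m gE V k l
  = gE V k l *m gE V i j + ((j == k)%:R *: gE V i l - (i == l)%:R *: gE V k j).
Proof. by rewrite -gE_rel addrC subrK. Qed.

Lemma L_lowest_string (K : numFieldType) (V : gl2module K) a b :
  is_L V a b -> exists m l, a = b + m%:R /\ lowest_string (gE V) b m l.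
Proof.
move=> [[_ irr] [v [v0 Ev E0v E1v]]].
pose E := gE V.
have c01 : E 0 1 *m E 1 0 - E 1 0 *m E 0 1 = E 0 0 - E 1 1.
  by rewrite gE_rel !scale1r.
have c10 : E 1 0 *m E 0 1 - E 0 1 *m E 1 0 = E 1 1 - E 0 0.
  by rewrite gE_rel !scale1r.
have h10 : (E 0 0 - E 1 1) *m E 1 0 - E 1 0 *m (E 0 0 - E 1 1) = - 2 *: E 1 0.
  rewrite mulmxBl mulmxBr /E (gl2_comm V 0 0 1 0) (gl2_comm V 1 1 1 0) /=.
  by mx_lin.
have h01 : (E 1 1 - E 0 0) *m E 0 1 - E 0 1 *m (E 1 1 - E 0 0) = - 2 *: E 0 1.
  rewrite mulmxBl mulmxBr /E (gl2_comm V 0 0 0 1) (gl2_comm V 1 1 0 1) /=.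
  by mx_lin.
have Hv : (E 0 0 - E 1 1) *m v = (a - b) *: v by rewrite mulmxBl E0v E1v scalerBl.
have [m [abm u0 um]] := sl2_highest_weight c01 h10 Ev Hv v0.
set u := iter m (mulmx (E 1 0)) v in u0 um.
have w10 k : E 0 0 *m iter k (mulmx (E 1 0)) v = (a - k%:R) *: iter k (mulmx (E 1 0)) v
    /\ E 1 1 *m iter k (mulmx (E 1 0)) v = (b + k%:R) *: iter k (mulmx (E 1 0)) v.
  elim: k => [|k [IH0 IH1]] /=; first by rewrite subr0 addr0.
  rewrite /E !mulmxA (gl2_comm V 0 0 1 0) (gl2_comm V 1 1 1 0) /= !mulmxDl -!mulmxA.
  rewrite -/E IH0 IH1 -!scalemxAr !mulNmx -!scalemxAl -natr1.
  by split; mx_lin.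
have aE : a = b + m%:R by rewrite -abm; ring.
have [u_0 u_1] := w10 m; rewrite -/u in u_0 u_1.
have Hu : (E 1 1 - E 0 0) *m u = m%:R *: u.
  by rewrite mulmxBl u_0 u_1 -scalerBl aE; congr (_ *: _); ring.
(* For the opposite sl_2-triple, in which [E 0 1] lowers, [u] is a highest vector of weight [m];
   hence the string from [u] upwards ends at [m.+1]. *)
have [m' [/eqP mm' _ end_]] := sl2_highest_weight c10 h01 um Hu u0.
move: mm' end_; rewrite eqr_nat => /eqP <- end_.
pose l k := iter k (mulmx (E 0 1)) u.
exists m, l; split=> //.
have l0 q : E 0 0 *m l q = (b + q%:R) *: l q.
  elim: q => [|q IH]; first by rewrite /l /= u_0 aE addr0 addrK.
  rewrite /l /= /E mulmxA (gl2_comm V 0 0 0 1) /= !mulmxDl -mulmxA -/E [E 0 0 *m _]IH.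
  by rewrite -!scalemxAr !mulNmx -!scalemxAl -natr1 /l; mx_lin.
have l1 q : E 1 1 *m l q = (b + m%:R - q%:R) *: l q.
  elim: q => [|q IH]; first by rewrite /l /= u_1 subr0.
  rewrite /l /= /E mulmxA (gl2_comm V 1 1 0 1) /= !mulmxDl -mulmxA -/E [E 1 1 *m _]IH.
  by rewrite -!scalemxAr !mulNmx -!scalemxAl -natr1 /l; mx_lin.
have l10 q : E 1 0 *m l q.+1 = (q.+1%:R * (m%:R - q%:R)) *: l q.
  have := @sl2_raise K _ _ _ _ c10 h01 m%:R u um Hu q. by [].
split=> // P Ps Pl w.
(* The span of the [l q] is stable under gl_2 and contains [u != 0], so irreducibility makes it the
   whole module. *)
pose W := (\sum_(q < m.+1) <[l q]>)%VS.
have lW q : l q \in W.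
  have lend : l m.+1 = 0 by exact: end_.
  have [qm|mq] := ltnP q m.+1.
    by apply: (subvP (sumv_sup (Ordinal qm) _ _)) (memv_line _).
  have -> : l q = 0; last exact: mem0v.
  by rewrite -(subnK mq); elim: (q - m.+1)%N => //= k; rewrite /l /= => ->; rewrite mulmx0.
have PW x : x \in W -> P x.
  move=> /memv_sumP [y yl ->]; apply: subspace_sum => // q _.
  by have /vlineP [c ->] := yl q isT; exact: subspaceZ.
have stableW i j x : x \in W -> E i j *m x \in W.
  move=> /memv_sumP [y yl ->]; rewrite mulmx_sumr; apply: memv_suml => q _.
  have /vlineP [c ->] := yl q isT; rewrite -scalemxAr memvZ //.
  case: (I2P i) (I2P j) => -> [] ->.
  - by rewrite l0 memvZ.
  - exact: (lW q.+1).
  - case: (q : nat) => [|q']; first by rewrite [_ *m _]um mem0v.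
    by rewrite l10 memvZ.
  - by rewrite l1 memvZ.
have [W0|Wf] := irr W stableW; last by apply: PW; rewrite Wf memvf.
by have := lW 0%N; rewrite W0 memv0 (negPf u0).
Qed.

(** * Tensor products *)

Section TensorAlgebra.
Variable K : fieldType.

Lemma tensmxDl m n p q (A B : 'M[K]_(m, n)) (C : 'M_(p, q)) :
  (A + B) *t C = A *t C + B *t C.
Proof. by apply/matrixP => i j; rewrite !mxE mulrDl. Qed.

Lemma tensmxDr m n p q (A B : 'M[K]_(m, n)) (C : 'M_(p, q)) :
  C *t (A + B) = C *t A + C *t B.
Proof. by apply/matrixP => i j; rewrite !mxE mulrDr. Qed.

Lemma tensmxNl m n p q (A : 'M[K]_(m, n)) (C : 'M_(p, q)) : (- A) *t C = - (A *t C).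
Proof. by apply/matrixP => i j; rewrite !mxE mulNr. Qed.

Lemma tensmxNr m n p q (A : 'M[K]_(m, n)) (C : 'M_(p, q)) : C *t (- A) = - (C *t A).
Proof. by apply/matrixP => i j; rewrite !mxE mulrN. Qed.

Lemma tensmxZl m n p q c (A : 'M[K]_(m, n)) (C : 'M_(p, q)) :
  (c *: A) *t C = c *: (A *t C).
Proof. by apply/matrixP => i j; rewrite !mxE mulrA. Qed.

Lemma tensmxZr m n p q c (A : 'M[K]_(m, n)) (C : 'M_(p, q)) :
  C *t (c *: A) = c *: (C *t A).
Proof. by apply/matrixP => i j; rewrite !mxE mulrCA. Qed.

Lemma tensmx_scalar m n (a b : K) : a%:M *t b%:M = (a * b)%:M :> 'M_(m * n).
Proof.
apply/matrixP => i j; case: (mxtens_indexP i) => i0 i1.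
case: (mxtens_indexP j) => j0 j1; rewrite tensmxE !mxE.
rewrite (can_eq (@mxtens_indexK _ _)) xpair_eqE.
by case: eqP; case: eqP; rewrite ?mulr0 ?mul0r ?mulr1n ?mulr0n.
Qed.

(** The Kronecker product of two columns has [1 * 1] columns; the definition fixes the convertible
    type ['cV]. *)
Definition tensv m n (l : 'cV[K]_m) (w : 'cV[K]_n) : 'cV[K]_(m * n) := l *t w.

Lemma tensvDl m n (x y : 'cV[K]_m) (w : 'cV[K]_n) :
  tensv (x + y) w = tensv x w + tensv y w.
Proof. exact: (tensmxDl (n := 1) (q := 1)). Qed.

Lemma tensvDr m n (x : 'cV[K]_m) (w z : 'cV[K]_n) :
  tensv x (w + z) = tensv x w + tensv x z.
Proof. exact: (tensmxDr (n := 1) (q := 1)). Qed.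

Lemma tensvZl m n c (x : 'cV[K]_m) (w : 'cV[K]_n) : tensv (c *: x) w = c *: tensv x w.
Proof. exact: (tensmxZl (n := 1) (q := 1)). Qed.

Lemma tensvZr m n c (x : 'cV[K]_m) (w : 'cV[K]_n) : tensv x (c *: w) = c *: tensv x w.
Proof. exact: (tensmxZr (n := 1) (q := 1)). Qed.

Lemma tensv0l m n (w : 'cV[K]_n) : tensv (0 : 'cV[K]_m) w = 0.
Proof. exact: (tens0mx (n := 1) (q := 1)). Qed.

Lemma tensv0r m n (x : 'cV[K]_m) : tensv x (0 : 'cV[K]_n) = 0.
Proof. exact: (tensmx0 (n := 1) (q := 1)). Qed.

Lemma tensmx_tensv m n p q (A : 'M_(m, n)) (B : 'M_(p, q)) l w :
  (A *t B) *m tensv l w = tensv (A *m l) (B *m w).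
Proof. exact: (tensmx_mul A B l w). Qed.

Lemma tensv_sumr m n (l : 'cV[K]_m) (J : finType) (c : J -> K) (F : J -> 'cV[K]_n) :
  \sum_j c j *: tensv l (F j) = tensv l (\sum_j c j *: F j).
Proof.
elim/big_rec2: _ => [|j x y _ ->]; first by rewrite tensv0r.
by rewrite tensvDr tensvZr.
Qed.

Lemma tensv_ind m n (P : 'cV[K]_(m * n) -> Prop) : subspace P ->
  (forall l w, P (tensv l w)) -> forall z, P z.
Proof.
move=> Ps Pt z; pose e i : 'cV[K]_m := delta_mx i 0.
pose zi i : 'cV[K]_n := \col_j z (mxtens_index (i, j)) 0.
have -> : z = \sum_i tensv (e i) (zi i); last exact: subspace_sum.
apply/colP => k; case: (mxtens_indexP k) => i j; rewrite summxE (bigD1 i) //=.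
rewrite big1 => [|i' i'i]; first by rewrite addr0 !mxE mxtens_indexK /= eqxx mul1r.
by rewrite !mxE mxtens_indexK /= andbT eq_sym (negPf i'i) mul0r.
Qed.

Lemma subspace_tensvl m n (P : 'cV[K]_(m * n) -> Prop) w :
  subspace P -> subspace (fun l => P (tensv l w)).
Proof.
move=> Ps; split=> [|c x y Px Py]; first by rewrite tensv0l; exact: Ps.1.
by rewrite tensvDl tensvZl; exact: Ps.2.
Qed.

Lemma subspace_tensvr m n (P : 'cV[K]_(m * n) -> Prop) l :
  subspace P -> subspace (fun w => P (tensv l w)).
Proof.
move=> Ps; split=> [|c x y Px Py]; first by rewrite tensv0r; exact: Ps.1.
by rewrite tensvDr tensvZr; exact: Ps.2.
Qed.
End TensorAlgebra.

Lemma mx_ext (K : fieldType) d (A B : 'M[K]_d) :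
  (forall w : 'cV_d, A *m w = B *m w) -> A = B.
Proof.
move=> h; apply/matrixP => i j; have /colP/(_ i) := h (delta_mx j 0).
by rewrite -!colE !mxE.
Qed.

Section LowestCyclic.
Variable K : numFieldType.

(* [chi u] is the eigenvalue of u^N t_22(u) on the lowest vector, and
   [lc_casimir] says that the u^-2 coefficient of qdet T(u) acts as a scalar. *)
Record lowest_cyclic (d : nat) (T : 'I_2 -> 'I_2 -> nat -> 'M[K]_d)
    (N : nat) (chi : K -> K) (beta : K) (M : nat) : Prop := LowestCyclic {
  lc_bound : forall i j r, (N < r)%N -> T i j r = 0;
  lc_cyclic : exists2 v0,
    forall u, \sum_(r < N.+1) u ^+ (N - r) *: (T 1 1 r *m v0) = chi u *: v0 &
    forall w, orbit_span (T 0 1) v0 w;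
  lc_weights : forall P, subspace P ->
    (forall k w, (k <= M)%N -> T 0 0 1%N *m w = (beta + k%:R) *: w -> P w) ->
    forall w, P w;
  lc_trace : T 0 0 1%N + T 1 1 1%N = (2 * beta + M%:R)%:M;
  lc_casimir : exists q, T 0 0 2%N + T 1 1 2%N + T 1 1 1%N
    + T 0 0 1%N *m T 1 1 1%N - T 1 0 1%N *m T 0 1 1%N = q%:M }.

Section String.
Variables (d : nat) (E : 'I_2 -> 'I_2 -> 'M[K]_d) (b : K) (m : nat).
Variable l : nat -> 'cV[K]_d.
Hypothesis El : lowest_string E b m l.

Lemma string_ext (A B : 'M[K]_d) : (forall q, A *m l q = B *m l q) -> A = B.
Proof.
move=> h; apply: mx_ext; apply: (string_span El) => //.
split=> [|c x y hx hy]; first by rewrite !mulmx0.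
by rewrite !mulmxDr -!scalemxAr hx hy.
Qed.

Lemma string_trace : E 0 0 + E 1 1 = (2 * b + m%:R)%:M.
Proof.
apply: string_ext => q; rewrite mulmxDl (string_E00 El) (string_E11 El).
by rewrite mul_scalar_mx -scalerDl; congr (_ *: _); ring.
Qed.

Lemma string_casimir :
  E 1 1 + E 0 0 *m E 1 1 - E 1 0 *m E 0 1 = (b * (b + m%:R + 1))%:M.
Proof.
apply: string_ext => q; rewrite mulmxBl mulmxDl -!mulmxA (string_E11 El).
rewrite (string_E01 El) (string_E10 El) -scalemxAr (string_E00 El) scalerA.
rewrite mul_scalar_mx -scalerDl -scalerBl; congr (_ *: _); rewrite -natr1; ring.
Qed.

Lemma string_vanish q : (m < q)%N -> l q = 0.
Proof.
move=> mq; rewrite -(subnK mq); elim: (q - m.+1)%N => [|k IH].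
  exact: string_end El.
by rewrite addSn -(string_E01 El) IH mulmx0.
Qed.
End String.

Lemma string_lowest_cyclic d (T : 'I_2 -> 'I_2 -> nat -> 'M[K]_d) b m l :
  (forall i j, T i j 0%N = (i == j)%:R%:M) ->
  (forall i j r, T i j r.+2 = 0) ->
  lowest_string (fun i j => T i j 1%N) b m l ->
  lowest_cyclic T 1 (fun u => u + (b + m%:R)) b m.
Proof.
move=> T0 T2 El; split.
- by move=> i j [|[|r]].
- exists (l 0%N) => [u|].
    rewrite big_ord_recl big_ord1 /bump /= T0 eqxx mul_scalar_mx subn0 subnn.
    rewrite !scale1r.
    by rewrite (string_E11 El) subr0 -scalerDl.
  apply: (string_span El); first exact: subspace_orbit.
  elim=> [|q IH]; first exact: orbit_base.
  by rewrite -(string_E01 El); exact: orbit_act.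
- move=> P Ps Pw; apply: (string_span El) => // q.
  have [qm|mq] := leqP q m; last by rewrite (string_vanish El mq); exact: Ps.1.
  by apply: (Pw q) => //; exact: (string_E00 El q).
- exact: string_trace El.
- by exists (b * (b + m%:R + 1)); rewrite !T2 !add0r; exact: string_casimir El.
Qed.

Section Tensor.
Variables (d1 d2 : nat) (E : 'I_2 -> 'I_2 -> 'M[K]_d1) (b : K) (m : nat).
Variables (l : nat -> 'cV[K]_d1) (T : 'I_2 -> 'I_2 -> nat -> 'M[K]_d2).
Variable TT : 'I_2 -> 'I_2 -> nat -> 'M[K]_(d1 * d2).
Hypothesis El : lowest_string E b m l.
Hypothesis T0 : forall i j, T i j 0%N = (i == j)%:R%:M.
Hypothesis TT0 : forall i j, TT i j 0%N = (i == j)%:R%:M.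
Hypothesis TTS : forall i j r, TT i j r.+1 =
  1%:M *t T i j r.+1 + (E i 0 *t T 0 j r + E i 1 *t T 1 j r).

Lemma tensor_act i j r x w : TT i j r.+1 *m tensv x w =
  tensv x (T i j r.+1 *m w)
  + (tensv (E i 0 *m x) (T 0 j r *m w) + tensv (E i 1 *m x) (T 1 j r *m w)).
Proof. by rewrite TTS !mulmxDl !tensmx_tensv mul1mx. Qed.

Variables (N : nat) (chi : K -> K) (beta : K) (M : nat).
Hypothesis TL : lowest_cyclic T N chi beta M.

(** The coproduct as an identity of polynomials in u: u^(N+1) t_ij(u) acts as the sum over k of (u
    delta_ik + E_ik) (x) u^N t_kj(u). *)
Lemma tensor_poly_act i j u x w :
  \sum_(r < N.+2) u ^+ (N.+1 - r) *: (TT i j r *m tensv x w) =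
  \sum_(r < N.+1) u ^+ (N - r) *: (tensv (u *: x) (T i j r *m w)
  + (tensv (E i 0 *m x) (T 0 j r *m w) + tensv (E i 1 *m x) (T 1 j r *m w))).
Proof.
rewrite big_ord_recl /= subn0 TT0.
under eq_bigr do rewrite /bump /= add1n subSS tensor_act scalerDr.
under [RHS]eq_bigr do rewrite scalerDr.
rewrite !big_split /= addrA; congr (_ + _).
have -> : (i == j)%:R%:M *m tensv x w = tensv x (T i j 0%N *m w).
  by rewrite T0 !mul_scalar_mx tensvZr.
transitivity (\sum_(r < N.+2) u ^+ (N.+1 - r) *: tensv x (T i j r *m w)).
  by rewrite [RHS]big_ord_recl.
rewrite big_ord_recr /= (lc_bound TL) // mul0mx tensv0r scaler0 addr0.
apply: eq_bigr => r _; rewrite tensvZl scalerA -exprSr subSn //.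
by rewrite -ltnS.
Qed.

Lemma tensor_lowest_cyclic :
  (forall q, (q < m)%N -> chi (- (b + q%:R)) != 0) ->
  lowest_cyclic TT N.+1 (fun u => (u + (b + m%:R)) * chi u) (b + beta) (m + M).
Proof.
move=> chi0; split.
- move=> i j [//|r] Nr; rewrite TTS !(lc_bound TL) ?tensmx0 ?addr0 //.
  exact: ltnW.
- have [v0 v0chi v0cyc] := lc_cyclic TL; exists (tensv (l 0%N) v0).
    move=> u; rewrite tensor_poly_act (string_E10_0 El) (string_E11 El) subr0.
    under eq_bigr => r _ do rewrite tensv0l add0r -tensvDl -scalerDl.
    by rewrite tensv_sumr v0chi tensvZl tensvZr scalerA.
  pose W := orbit_span (TT 0 1) (tensv (l 0%N) v0).
  have Ws : subspace W by exact: subspace_orbit.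
  have Wv0 q : W (tensv (l q) v0).
    have [qm|/string_vanish] := leqP q m; last first.
      by move=> /(_ _ _ _ _ El) ->; rewrite tensv0l; exact: Ws.1.
    elim: q qm => [|q IH] qm; first exact: orbit_base.
    apply: (subspaceZ_inv Ws (chi0 q qm)).
    (* At this u the operator u + E_00 kills [l q], so t_12(u) acts only through E_01 (x) t_22(u),
       and [v0] is an eigenvector of t_22(u). *)
    set u := - (b + q%:R).
    have <- : \sum_(r < N.+2) u ^+ (N.+1 - r) *: (TT 0 1 r *m tensv (l q) v0)
        = chi u *: tensv (l q.+1) v0.
      rewrite tensor_poly_act (string_E00 El) (string_E01 El).
      under eq_bigr => r _ do
        rewrite addrA -tensvDl -scalerDl addNr scale0r tensv0l add0r.
      by rewrite tensv_sumr v0chi tensvZr.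
    apply: subspace_sum => // r _; apply: subspaceZ => //; apply: orbit_act.
    by apply: IH; exact: ltnW.
  (* This is descending induction on [q], with [k] bounding the distance from [q] to [m.+1]. *)
  have Wall k q w : (m < q + k)%N -> W (tensv (l q) w).
    elim: k q w => [|k IH] q w mq.
      rewrite addn0 in mq; rewrite (string_vanish El mq) tensv0l; exact: Ws.1.
    elim: (v0cyc w) => [|c x y _ hx _ hy|r x _ hx]; first exact: Wv0.
      by apply: (subspace_tensvr (l q) Ws).2.
    (* The action of t_12^(r+1) on [l q] (x) x gives the desired vector plus a term with t_12^(r) on
       the second factor, covered by [IHr], and a term with [l q.+1] in the first, covered by
       [IH]. *)
    elim: r => [|r IHr].
      by rewrite T0 mul_scalar_mx scale0r tensv0r; exact: Ws.1.
    have := orbit_act r.+1 hx; rewrite -/W tensor_act.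
    rewrite (string_E00 El) (string_E01 El); set y := (X in _ + X) => Wx.
    have Wy : W y.
      apply: subspaceD => //; last by apply: IH; rewrite addSnnS.
      by rewrite tensvZl; exact: subspaceZ.
    by have := subspaceB Ws Wx Wy; rewrite addrK.
  apply: tensv_ind => // x w; move: x.
  apply: (string_span El) => [|q]; first exact: (subspace_tensvl w Ws).
  by apply: (Wall m.+1); rewrite addnS ltnS leq_addl.
- move=> P Ps Pw; apply: tensv_ind => // x w; move: x.
  apply: (string_span El) => [|q]; first exact: (subspace_tensvl w Ps).
  have [qm|/(string_vanish El) ->] := leqP q m; last first.
    by rewrite tensv0l; exact: Ps.1.
  move: w; apply: (lc_weights TL) => [|k w kM wk]; first exact: (subspace_tensvr _ Ps).
  apply: (Pw (q + k)%N); first exact: leq_add.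
  rewrite tensor_act !T0 wk (string_E00 El) !mul_scalar_mx /=.
  rewrite scale1r scale0r tensv0r addr0 tensvZl tensvZr -scalerDl natrD.
  by congr (_ *: _); ring.
- rewrite !TTS !T0 /= !rmorph0 !tensmx0 addr0 add0r.
  have -> : 1%:M *t T 0 0 1%N + E 0 0 *t 1%:M + (1%:M *t T 1 1 1%N + E 1 1 *t 1%:M)
      = 1%:M *t (T 0 0 1%N + T 1 1 1%N) + (E 0 0 + E 1 1) *t (1%:M : 'M_d2).
    rewrite tensmxDr tensmxDl; mx_lin.
  rewrite (lc_trace TL) (string_trace El) !tensmx_scalar -rmorphD natrD.
  by congr (_%:M); ring.
have [q qE] := lc_casimir TL.
(* The quantum determinant is group-like: its u^-2 coefficient is the sum of those of the two
   factors plus the product of their u^-1 coefficients, which are the traces. *)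
exists (q + b * (b + m%:R + 1) + (2 * b + m%:R) * (2 * beta + M%:R)).
have qTT : TT 0 0 2%N + TT 1 1 2%N + TT 1 1 1%N + TT 0 0 1%N *m TT 1 1 1%N
    - TT 1 0 1%N *m TT 0 1 1%N =
  1%:M *t (T 0 0 2%N + T 1 1 2%N + T 1 1 1%N + T 0 0 1%N *m T 1 1 1%N
           - T 1 0 1%N *m T 0 1 1%N)
  + (E 1 1 + E 0 0 *m E 1 1 - E 1 0 *m E 0 1) *t 1%:M
  + (E 0 0 + E 1 1) *t (T 0 0 1%N + T 1 1 1%N).
  rewrite !TTS !T0 /= !rmorph0 !tensmx0 !addr0 !add0r.
  rewrite !mulmxDl !mulmxDr !tensmx_mul !mulmx1 !mul1mx.
  rewrite !(tensmxDl, tensmxDr, tensmxNl, tensmxNr).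
  by mx_lin.
rewrite qTT qE (lc_trace TL) (string_trace El) (string_casimir El) !tensmx_scalar.
by rewrite -!rmorphD mul1r mulr1.
Qed.
End Tensor.
End LowestCyclic.

(** * Commuting transfer matrices and unipotent conjugation *)

Section TraceCommute.
Variables (K : fieldType) (d : nat) (T : 'I_2 -> 'I_2 -> nat -> 'M[K]_d).
Hypothesis hT : yangian_rel T.

Lemma yangian_rel1 i j k l s :
  T i j 1%N *m T k l s - T k l s *m T i j 1%N
  = (k == j)%:R *: T i l s - (i == l)%:R *: T k j s.
Proof.
have := hT.2 i j k l 0%N s; rewrite !hT.1 -!mulmxE.
have natE (b : bool) : (b%:R : 'M[K]_d) = b%:R%:M by case: b; rewrite ?rmorph0 ?rmorph1.
rewrite !natE !mul_scalar_mx !mul_mx_scalar !subrr subr0 => ->.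
by [].
Qed.

Variable C : 'M[K]_2.
Let X i j r := \sum_a C a j *: T i a r.

Lemma twisted_mul i j k l r s : X i j r *m X k l s =
  \sum_a \sum_b (C a j * C b l) *: (T i a r *m T k b s).
Proof.
rewrite mulmx_suml; apply: eq_bigr => a _; rewrite mulmx_sumr.
by apply: eq_bigr => b _; rewrite -scalemxAl -scalemxAr scalerA.
Qed.

Lemma twisted_mul' i j k l r s : X k l s *m X i j r =
  \sum_a \sum_b (C a j * C b l) *: (T k b s *m T i a r).
Proof.
rewrite twisted_mul exchange_big; apply: eq_bigr => a _; apply: eq_bigr => b _.
by rewrite mulrC.
Qed.

(** Each term of the relation for T(u) has one factor with column j and one with column l, so the
    relation can be contracted with two copies of C. *)
Lemma twisted_rel i j k l r s :
  (X i j r.+1 *m X k l s - X k l s *m X i j r.+1)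
  - (X i j r *m X k l s.+1 - X k l s.+1 *m X i j r)
  = X k j r *m X i l s - X k j s *m X i l r.
Proof.
rewrite !(twisted_mul' i j k l) !twisted_mul -!sumrB; apply: eq_bigr => a _.
rewrite -!sumrB; apply: eq_bigr => b _; rewrite -!scalerBr.
by have := hT.2 i a k b r s; rewrite -!mulmxE => ->.
Qed.

Let bracket (A B : 'M[K]_d) := A *m B - B *m A.
Let F r s := \sum_i \sum_k bracket (X i i r) (X k k s).
Let G r s := \sum_i \sum_k bracket (X k i r) (X i k s).

(** Summing [twisted_rel] over the diagonal gives F(r+1, s) - F(r, s+1) = G(r, s), and the same with
    F and G exchanged. Both vanish at r = 0, where X is scalar, hence everywhere by induction on
    r. *)
Lemma twisted_trace_comm r s :
  (\sum_i X i i r) *m (\sum_i X i i s) = (\sum_i X i i s) *m (\sum_i X i i r).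
Proof.
have FS p q : F p.+1 q = F p q.+1 + G p q.
  rewrite addrC; apply/eqP; rewrite -subr_eq; apply/eqP.
  rewrite /F /G /bracket -sumrB.
  under eq_bigr do rewrite -sumrB.
  under eq_bigr => i _ do under eq_bigr => k _ do rewrite twisted_rel.
  under eq_bigr do rewrite sumrB.
  under [RHS]eq_bigr do rewrite sumrB.
  by rewrite !sumrB [X in _ - X = _]exchange_big.
have GS p q : G p.+1 q = G p q.+1 + F p q.
  rewrite addrC; apply/eqP; rewrite -subr_eq; apply/eqP.
  rewrite /F /G /bracket -sumrB.
  under eq_bigr do rewrite -sumrB.
  under eq_bigr => i _ do under eq_bigr => k _ do rewrite twisted_rel.
  under eq_bigr do rewrite sumrB.
  under [RHS]eq_bigr do rewrite sumrB.
  by rewrite !sumrB [X in _ - X = _]exchange_big.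
have br0 i j A : bracket (X i j 0%N) A = 0.
  rewrite /bracket /X.
  have -> : \sum_a C a j *: T i a 0%N = (\sum_a C a j * (i == a)%:R)%:M.
    rewrite rmorph_sum; apply: eq_bigr => a _ /=.
    by rewrite hT.1; case: eqP => _; rewrite ?mulr1 ?mulr0 ?rmorph0 ?scaler0 // scalemx1.
  by rewrite mul_scalar_mx mul_mx_scalar subrr.
have FG0 : forall p q, F p q = 0 /\ G p q = 0.
  elim=> [|p IH] q.
    by split; rewrite ?/F ?/G; do 2!(apply: big1 => ? _); rewrite br0.
  by rewrite FS GS (IH q).1 (IH q).2 (IH q.+1).1 (IH q.+1).2 addr0.
apply/eqP; rewrite -subr_eq0 -[X in _ == X](FG0 r s).1 /F /bracket.
rewrite mulmx_suml mulmx_sumr -sumrB; apply/eqP; apply: eq_bigr => i _.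
by rewrite mulmx_sumr mulmx_suml -sumrB.
Qed.
End TraceCommute.

Section Exponential.
Variables (K : numFieldType) (d : nat) (e : 'M[K]_d) (x : K).

(* [B k.+2] stands for x^k e^k / k!; the two leading zeros avoid negative indices. *)
Lemma exp_terms_comm (B : nat -> 'M[K]_d) (t0 t1 t2 : 'M[K]_d) k :
  B 0%N = 0 -> B 1%N = 0 -> B 2%N = 1%:M ->
  (forall k, x *: (e *m B k) = (k%:R - 1) *: B k.+1) ->
  e *m t0 = t0 *m e + t1 -> e *m t1 = t1 *m e + t2 -> e *m t2 = t2 *m e ->
  B k.+2 *m t0 = t0 *m B k.+2 + x *: (t1 *m B k.+1) + (x ^+ 2 / 2) *: (t2 *m B k).
Proof.
move=> B0 B1 B2 eB e0 e1 e2; elim: k => [|k IH].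
  by rewrite B0 B1 B2 !mulmx0 !scaler0 !addr0 mul1mx mulmx1.
have k0 : k.+1%:R != 0 :> K by rewrite pnatr_eq0.
apply: (scalerI k0).
have -> : k.+1%:R *: (B k.+3 *m t0) = x *: (e *m (B k.+2 *m t0)).
  by rewrite mulmxA [RHS]scalemxAl eB -[k.+2%:R]natr1 addrK; exact: scalemxAl.
have -> : x *: (e *m (B k.+2 *m t0)) =
    t0 *m (x *: (e *m B k.+2)) + x *: (t1 *m B k.+2)
    + x *: (t1 *m (x *: (e *m B k.+1))) + x *: (x *: (t2 *m B k.+1))
    + (x ^+ 2 / 2) *: (t2 *m (x *: (e *m B k))).
  rewrite IH !mulmxDr -!scalemxAr !mulmxA e0 e1 e2 !mulmxDl; mx_lin.
rewrite !eB -!scalemxAr -!natr1.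
by apply/matrixP => ? ?; rewrite !mx_linE; field.
Qed.

(** Here G = exp(x e), and conjugation by it is exp(x ad e), cut off after the second order. As G -
    1 maps into the image of [e], [nakayama] makes G surjective. *)
Lemma exponential_conjugation : nilpotent e -> exists2 G : 'M[K]_d,
  forall w : 'cV_d, exists z, w = G *m z &
  forall t0 t1 t2 : 'M[K]_d, e *m t0 = t0 *m e + t1 ->
    e *m t1 = t1 *m e + t2 -> e *m t2 = t2 *m e ->
    G *m t0 = (t0 + x *: t1 + (x ^+ 2 / 2) *: t2) *m G.
Proof.
move=> [n en].
pose B (k : nat) : 'M[K]_d :=
  if k is k'.+2 then (x ^+ k' / k'`!%:R) *: iter k' (mulmx e) 1%:M else 0.
have eB k : x *: (e *m B k) = (k%:R - 1) *: B k.+1.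
  case: k => [|[|k]] /=; rewrite ?mulmx0 ?scaler0 ?subrr ?scale0r //.
  rewrite -scalemxAr !scalerA; congr (_ *: _).
  have k0 : k.+1%:R != 0 :> K by rewrite pnatr_eq0.
  have f0 : k`!%:R != 0 :> K by rewrite pnatr_eq0 -lt0n fact_gt0.
  rewrite factS natrM exprS -[k.+2%:R]natr1; field.
  by rewrite f0 nat1r k0.
have B2 : B 2%N = 1%:M by rewrite /= expr0 fact0 divr1 scale1r.
have B0 k : (n <= k)%N -> B k.+2 = 0.
  move=> nk; rewrite /B; have -> : iter k (mulmx e) 1%:M = 0; last by rewrite scaler0.
  apply: mx_ext => w; rewrite mul0mx.
  have -> : iter k (mulmx e) 1%:M *m w = iter k (mulmx e) w.
    by elim: (k) => [|k' IH] /=; rewrite ?mul1mx // -mulmxA IH.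
  rewrite -(subnK nk) iterD en; elim: (k - n)%N => //= k' ->; exact: mulmx0.
pose G := \sum_(k < n.+2) B k.+2.
(* [B] is zero at 0, at 1 and from [n.+2] on, so shifting the index leaves the sum unchanged. The
   three shifts match the three terms of [exp_terms_comm]. *)
have G1 : G = \sum_(k < n.+2) B k.+1.
  by rewrite [RHS]big_ord_recl add0r /G big_ord_recr [B _]B0 /= ?addr0.
have G2 : G = \sum_(k < n.+2) B k.
  by rewrite G1 [RHS]big_ord_recl add0r big_ord_recr [B _]B0 /= ?addr0.
have Ge (t0 t1 t2 : 'M[K]_d) : e *m t0 = t0 *m e + t1 ->
    e *m t1 = t1 *m e + t2 -> e *m t2 = t2 *m e ->
    G *m t0 = (t0 + x *: t1 + (x ^+ 2 / 2) *: t2) *m G.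
  move=> e0 e1 e2; rewrite !mulmxDl -!scalemxAl.
  have -> : t1 *m G = \sum_(k < n.+2) t1 *m B k.+1 by rewrite G1 mulmx_sumr.
  have -> : t2 *m G = \sum_(k < n.+2) t2 *m B k by rewrite G2 mulmx_sumr.
  rewrite /G mulmx_suml mulmx_sumr !scaler_sumr -!big_split /=.
  by apply: eq_bigr => k _; apply: exp_terms_comm.
exists G; last exact: Ge.
apply: (@nakayama K d (fun w => exists z, w = G *m z) e).
- split=> [|c _ _ [z ->] [y ->]]; first by exists 0; rewrite mulmx0.
  by exists (c *: z + y); rewrite mulmxDr -scalemxAr.
- by exists n.
- move=> _ [z ->]; exists (e *m z); rewrite !mulmxA (Ge e 0 0) ?mulmx0 ?mul0mx ?addr0 //.
  by rewrite !scaler0 !addr0.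
move=> w; exists (G *m w); first by exists w.
have -> : w - G *m w = - (\sum_(k < n.+1) B k.+3) *m w.
  rewrite /G big_ord_recl mulmxDl [B _]B2 mul1mx opprD addNKr.
  by rewrite mulNmx.
rewrite mulNmx -scaleN1r; apply: subspaceZ; first exact: subspace_image.
rewrite mulmx_suml; apply: subspace_sum => [|k _]; first exact: subspace_image.
exists ((x ^+ k.+1 / k.+1`!%:R) *: (iter k (mulmx e) 1%:M *m w)).
by rewrite /B /= -scalemxAr mulmxA -scalemxAl.
Qed.
End Exponential.

(** * Weight projections and torus degeneration *)

Lemma prod_mx_eigen (K : fieldType) d (J : Type) (r : seq J) (Q : pred J)
    (F : J -> 'M[K]_d) (c : J -> K) (w : 'cV_d) :
  (forall j, F j *m w = c j *: w) ->
  (\prod_(j <- r | Q j) F j) *m w = (\prod_(j <- r | Q j) c j) *: w.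
Proof.
move=> Fw; elim/big_rec2: _ => [|j x y _ yw]; first by rewrite mul1mx scale1r.
by rewrite -mulmxE -mulmxA yw -scalemxAr Fw scalerA mulrC.
Qed.

Section Weights.
Variables (K : numFieldType) (d : nat) (H : 'M[K]_d) (beta : K) (M : nat).
Hypothesis HW : forall P, subspace P ->
  (forall k w, (k <= M)%N -> H *m w = (beta + k%:R) *: w -> P w) -> forall w, P w.

(** [HW] expresses that H is diagonalizable with eigenvalues among beta, ..., beta + M; matrices can
    then be compared on weight vectors. *)
Lemma weight_ext m (A B : 'M[K]_(m, d)) :
  (forall k (w : 'cV_d), (k <= M)%N -> H *m w = (beta + k%:R) *: w ->
     A *m w = B *m w) -> A = B.
Proof.
move=> h; have hw : forall w : 'cV_d, A *m w = B *m w.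
  apply: HW h; split=> [|c x y hx hy]; first by rewrite !mulmx0.
  by rewrite !mulmxDr -!scalemxAr hx hy.
apply/matrixP => i j; have /colP/(_ i) := hw (delta_mx j 0).
by rewrite -!colE !mxE.
Qed.

(** The Lagrange interpolation polynomial in H, that is, the projection to weight beta + k. For k >
    M no factor is left out and the product is 0. *)
Definition weight_proj (k : nat) : 'M[K]_d :=
  \prod_(j < M.+1 | j != k :> nat) ((k%:R - j%:R)^-1 *: (H - (beta + j%:R)%:M)).
Local Notation "'pi_" := weight_proj (at level 0).

Let proj_weight_le k j (w : 'cV_d) : (j <= M)%N -> H *m w = (beta + j%:R) *: w ->
  'pi_ k *m w = (k == j)%:R *: w.
Proof.
move=> jM Hw; rewrite (@prod_mx_eigen _ _ _ _ _ _
  (fun i : 'I_M.+1 => (k%:R - i%:R)^-1 * (j%:R - i%:R))) => [|i]; last first.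
  by rewrite -scalemxAl mulmxBl Hw mul_scalar_mx -scalerBl scalerA; congr (_ * _ *: _); ring.
congr (_ *: _); case: eqVneq => [->|kj].
  apply: big1 => i ij; rewrite mulVf // subr_eq0 eqr_nat.
  by rewrite eq_sym.
have jE : (inord j : 'I_M.+1) = j :> nat by rewrite inordK.
rewrite (bigD1 (inord j)) /=; last by rewrite jE eq_sym.
by rewrite jE subrr mulr0 mul0r.
Qed.

Lemma proj_sum : \sum_(k < M.+1) 'pi_ k = 1%:M.
Proof.
apply: weight_ext => j w jM Hw; rewrite mulmx_suml mul1mx.
rewrite (bigD1 (inord j)) //= big1 => [|k kj].
  by rewrite addr0 (proj_weight_le _ jM Hw) inordK // eqxx scale1r.
rewrite (proj_weight_le _ jM Hw).
case: (eqVneq (k : nat) j) kj => [<-|_ _]; last by rewrite scale0r.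
by rewrite inord_val eqxx.
Qed.

Lemma weight_proj_comm k : 'pi_ k *m H = (beta + k%:R) *: 'pi_ k.
Proof.
apply: weight_ext => j w jM Hw; rewrite -mulmxA Hw -scalemxAl -scalemxAr.
rewrite (proj_weight_le _ jM Hw); case: eqVneq => [->//|_].
by rewrite !scale0r !scaler0.
Qed.

Lemma weight_vanish mu (w : 'cV_d) : H *m w = mu *: w ->
  (forall k, (k <= M)%N -> mu != beta + k%:R) -> w = 0.
Proof.
move=> Hw muk; rewrite -[w]mul1mx -proj_sum mulmx_suml big1 // => k _.
have := congr1 (mulmx ('pi_ k)) Hw; rewrite mulmxA weight_proj_comm.
rewrite -scalemxAl -scalemxAr => /eqP; rewrite -subr_eq0 -scalerBl scaler_eq0.
have kM : (k <= M)%N by rewrite -ltnS.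
by rewrite subr_eq0 eq_sym (negPf (muk k kM)) => /eqP.
Qed.

Lemma proj_weight k j (w : 'cV_d) : H *m w = (beta + j%:R) *: w -> 'pi_ k *m w = (k == j)%:R *: w.
Proof.
move=> Hw; have [jM|Mj] := leqP j M; first exact: proj_weight_le.
rewrite (weight_vanish Hw) ?mulmx0 ?scaler0 // => i iM.
rewrite (inj_eq (addrI _)) eqr_nat; apply: contraTneq Mj => ->.
by rewrite -leqNgt.
Qed.

Lemma weight_mulr_proj k : H *m 'pi_ k = (beta + k%:R) *: 'pi_ k.
Proof.
apply: weight_ext => j w jM Hw; rewrite -mulmxA -scalemxAl (proj_weight _ Hw).
rewrite -scalemxAr Hw; case: eqVneq => [->|_]; first by rewrite !scale1r.
by rewrite !scale0r scaler0.
Qed.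

Lemma proj_idem k j : 'pi_ k *m 'pi_ j = (k == j)%:R *: 'pi_ j.
Proof.
apply: weight_ext => i w _ _; rewrite -mulmxA -scalemxAl; apply: proj_weight.
by rewrite mulmxA weight_mulr_proj -scalemxAl.
Qed.

Definition degree (c : K) (Z : 'M[K]_d) := H *m Z = Z *m H + c *: Z.

Lemma degree_weight c Z j (w : 'cV_d) : degree c Z -> H *m w = (beta + j) *: w ->
  H *m (Z *m w) = (beta + (j + c)) *: (Z *m w).
Proof.
by move=> dZ Hw; rewrite mulmxA dZ mulmxDl -mulmxA Hw -scalemxAl -scalemxAr -scalerDl addrA.
Qed.

Lemma proj_degree0 k Z : degree 0 Z -> 'pi_ k *m Z = Z *m 'pi_ k.
Proof.
move=> dZ; apply: weight_ext => j w jM Hw; rewrite -!mulmxA (proj_weight _ Hw).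
have := degree_weight dZ Hw; rewrite addr0 => /proj_weight ->.
by rewrite -scalemxAr.
Qed.

Lemma proj_degree1 k Z : degree 1 Z -> 'pi_ k.+1 *m Z = Z *m 'pi_ k.
Proof.
move=> dZ; apply: weight_ext => j w jM Hw; rewrite -!mulmxA (proj_weight _ Hw).
have := degree_weight dZ Hw; rewrite natr1 => /proj_weight ->.
by rewrite eqSS -scalemxAr.
Qed.

Lemma proj0_degree1 Z : degree 1 Z -> 'pi_ 0%N *m Z = 0.
Proof.
move=> dZ; apply: weight_ext => j w jM Hw; rewrite -!mulmxA mul0mx.
by have := degree_weight dZ Hw; rewrite natr1 => /proj_weight ->; rewrite scale0r.
Qed.

Lemma degree1_nilpotent Z : degree 1 Z -> nilpotent Z.
Proof.
move=> dZ; exists M.+1; apply: HW => [|k w kM Hw].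
  split=> [|c x y hx hy]; first by elim: M.+1 => //= n IH; rewrite IH mulmx0.
  rewrite iter_mulmxD hy addr0.
  by have -> : forall n, iter n (mulmx Z) (c *: x) = c *: iter n (mulmx Z) x;
    [elim=> //= n ->; rewrite -scalemxAr | rewrite hx scaler0].
have Hn n : H *m iter n (mulmx Z) w = (beta + (k + n)%:R) *: iter n (mulmx Z) w.
  elim: n => [|n IH]; first by rewrite addn0.
  by rewrite /= (degree_weight dZ IH) natr1 addnS.
apply: (weight_vanish (Hn M.+1)) => j jM; rewrite (inj_eq (addrI _)) eqr_nat.
by apply: contraTneq jM => <-; rewrite -ltnNge addnS ltnS leq_addl.
Qed.

(** The one-parameter group s^(H - beta), normalized to be polynomial in s. *)
Definition torus (s : K) := \sum_(k < M.+1) s ^+ k *: 'pi_ k.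

Lemma torus_weight s j (w : 'cV_d) : H *m w = (beta + j%:R) *: w -> torus s *m w = s ^+ j *: w.
Proof.
move=> Hw; have [jM|Mj] := leqP j M; last first.
  rewrite (weight_vanish Hw) ?mulmx0 ?scaler0 // => i iM.
  rewrite (inj_eq (addrI _)) eqr_nat; apply: contraTneq Mj => ->.
  by rewrite -leqNgt.
rewrite mulmx_suml (bigD1 (inord j)) //= big1 => [|k kj].
  by rewrite addr0 -scalemxAl (proj_weight _ Hw) inordK // eqxx scale1r.
rewrite -scalemxAl (proj_weight _ Hw); case: (eqVneq (k : nat) j) kj => [<-|_ _].
  by rewrite inord_val eqxx.
by rewrite scale0r scaler0.
Qed.

Lemma torus_surj s : s != 0 -> forall w : 'cV_d, exists z, w = torus s *m z.
Proof.
move=> s0 w; exists (torus s^-1 *m w); rewrite mulmxA.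
have -> : torus s *m torus s^-1 = 1%:M; last by rewrite mul1mx.
apply: weight_ext => j w' jM Hw; rewrite -mulmxA mul1mx (torus_weight _ Hw).
by rewrite -scalemxAr (torus_weight _ Hw) scalerA -exprMn mulVf // expr1n scale1r.
Qed.

Lemma torus_degree0 s Z : degree 0 Z -> torus s *m Z = Z *m torus s.
Proof.
move=> dZ; apply: weight_ext => j w jM Hw; rewrite -!mulmxA (torus_weight _ Hw).
have := degree_weight dZ Hw; rewrite addr0 => /torus_weight ->.
by rewrite -scalemxAr.
Qed.

Lemma torus_degree1 s Z : degree 1 Z -> torus s *m Z = s *: (Z *m torus s).
Proof.
move=> dZ; apply: weight_ext => j w jM Hw; rewrite -scalemxAl -!mulmxA (torus_weight _ Hw).
have := degree_weight dZ Hw; rewrite natr1 => /torus_weight ->.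
by rewrite -scalemxAr scalerA exprS.
Qed.

Lemma torus_degreeN1 s Z : degree (-1) Z -> s *: (torus s *m Z) = Z *m torus s.
Proof.
move=> dZ; apply: weight_ext => j w jM Hw; rewrite -scalemxAl -!mulmxA (torus_weight _ Hw).
(* On the lowest weight, j = 0, the vector [Z *m w] would have weight beta - 1, so both sides
   vanish. *)
have neg_weight (i : nat) : beta + (-1) != beta + i%:R.
  by rewrite (inj_eq (addrI _)) -subr_eq0 -opprD oppr_eq0 addrC natr1 pnatr_eq0.
have := degree_weight dZ Hw; case: j jM {Hw} => [|j] jM.
  rewrite add0r => HZ; rewrite (weight_vanish HZ) => [|i _].
    by rewrite mulmx0 scaler0 -scalemxAr (weight_vanish HZ) ?scaler0 // => i _; exact: neg_weight.
  exact: neg_weight.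
rewrite -natr1 addrK => /torus_weight ->.
by rewrite scalerA -exprS -scalemxAr.
Qed.

(** Conjugation by [torus s] fixes A and turns U + s D + s^2 L into s (U + D + L). At s = 0 the
    polynomial family is A together with U, so [cyclic_open] provides a usable s != 0. *)
Lemma torus_cyclic (J I : Type) (A : J -> 'M[K]_d) (U D L : I -> 'M[K]_d) :
  (forall j, degree 0 (A j)) -> (forall i, degree 1 (U i)) ->
  (forall i, degree 0 (D i)) -> (forall i, degree (-1) (L i)) ->
  cyclic (fun x : J + I => match x with inl j => A j | inr i => U i end) ->
  cyclic (fun x : J + I => match x with inl j => A j | inr i => U i + D i + L i end).
Proof.
move=> dA dU dD dL cAU.
pose P (Z : 'M[K]_d) := map_mx polyC Z.
pose X (x : J + I) := match x with inl j => P (A j)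
  | inr i => P (U i) + 'X *: P (D i) + 'X^2 *: P (L i) end.
have XE s x : map_mx (horner_eval s) (X x) = match x with inl j => A j
    | inr i => U i + s *: D i + s ^+ 2 *: L i end.
  by case: x => [j|i]; apply/matrixP => ? ?; rewrite !mxE /horner_eval !hornerE.
have [|s s0] := @cyclic_open K d (J + I) X.
  have [v vU] := cAU; exists v => w; elim: (vU w) => [|c x y _ hx _ hy|i x _ hx].
  - exact: orbit_base.
  - exact: orbit_lin.
  have := orbit_act i hx; rewrite XE; case: i => // i.
  by rewrite expr0n /= !scale0r !addr0.
apply: cyclic_transport (torus_surj s0) _ => -[j|i]; rewrite XE.
  by exists 1; rewrite scale1r torus_degree0.
exists s; rewrite !mulmxDr !mulmxDl -!scalemxAr (torus_degree1 _ (dU i)).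
rewrite (torus_degree0 _ (dD i)) -(torus_degreeN1 _ (dL i)).
by rewrite !scalerDr scalerA expr2.
Qed.
End Weights.

(** * The Casimir element modulo the raising operator *)

Section YangianDegrees.
Variables (K : numFieldType) (d : nat) (T : 'I_2 -> 'I_2 -> nat -> 'M[K]_d).
Hypothesis hT : yangian_rel T.

Lemma degree_diag i s : degree (T 0 0 1%N) 0 (T i i s).
Proof.
apply/eqP; rewrite /degree scale0r addr0 -subr_eq0 yangian_rel1 //.
by case: (I2P i) => ->; rewrite /= ?scale0r subrr.
Qed.

Lemma degree_raise s : degree (T 0 0 1%N) 1 (T 0 1 s).
Proof.
by apply/eqP; rewrite /degree addrC -subr_eq yangian_rel1 //= scale0r subr0.
Qed.

Lemma degree_lower s : degree (T 0 0 1%N) (-1) (T 1 0 s).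
Proof.
apply/eqP; rewrite /degree addrC -subr_eq yangian_rel1 //=.
by rewrite scale0r sub0r scaleN1r scale1r.
Qed.

Lemma trace_raise_comm s :
  (T 0 0 s + T 1 1 s) *m T 0 1 1%N = T 0 1 1%N *m (T 0 0 s + T 1 1 s).
Proof.
apply/esym/eqP; rewrite -subr_eq0 mulmxDr mulmxDl opprD addrACA !yangian_rel1 //=.
by rewrite !scale0r sub0r subr0 addNr.
Qed.

Lemma raise_comm s : T 0 1 s *m T 0 1 1%N = T 0 1 1%N *m T 0 1 s.
Proof. by apply/esym/eqP; rewrite -subr_eq0 yangian_rel1 //= !scale0r subrr. Qed.

Lemma twisted_transfer_comm r s :
  (T 0 0 r + T 1 1 r + T 0 1 r) *m (T 0 0 s + T 1 1 s + T 0 1 s)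
  = (T 0 0 s + T 1 1 s + T 0 1 s) *m (T 0 0 r + T 1 1 r + T 0 1 r).
Proof.
have tE p : T 0 0 p + T 1 1 p + T 0 1 p =
    \sum_i \sum_a (1%:M + delta_mx 1 0 : 'M[K]_2) a i *: T i a p.
  rewrite !big_ord_recl !big_ord0; have -> : lift ord0 ord0 = 1 :> 'I_2 by apply/val_inj.
  by rewrite !mxE /=; mx_lin.
by rewrite !tE twisted_trace_comm.
Qed.
End YangianDegrees.

Lemma image_mod_comm (K : fieldType) d (e Z : 'M[K]_d) x :
  Z *m e = e *m Z -> image_mod e x -> image_mod e (Z *m x).
Proof. by move=> Ze [z ->]; exists (Z *m z); rewrite !mulmxA Ze. Qed.

Section TransferAlgebra.
Variables (K : numFieldType) (d : nat) (T : 'I_2 -> 'I_2 -> nat -> 'M[K]_d).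
Hypothesis hT : yangian_rel T.
Variables (N : nat) (chi : K -> K) (beta : K) (M : nat).
Hypothesis TL : lowest_cyclic T N chi beta M.

Local Notation H := (T 0 0 1%N).
Local Notation e := (T 0 1 1%N).
Local Notation f := (T 1 0 1%N).
Local Notation tau r := (T 0 0 r + T 1 1 r).
Local Notation taup r := (T 0 0 r + T 1 1 r + T 0 1 r).
Local Notation "'pi_" := (weight_proj H beta M) (at level 0).
Local Notation I := (image_mod e).
Let HW := lc_weights TL.
Let Is : subspace I := subspace_image e.

(** The torus degenerates tr (I + E_21) T(u) to t_12(u); nothing is held fixed, hence the index type
    [void]. *)
Lemma cyclic_twisted_transfer : cyclic (fun r => taup r).
Proof.
have [v0 _ vT] := lc_cyclic TL.
have [|||||v vc] := @torus_cyclic K d H beta M HW void nat (fun _ => 0)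
  (T 0 1) (fun r => tau r) (fun=> 0).
- by [].
- exact: degree_raise.
- move=> r; have := degree_diag hT 0 r; have := degree_diag hT 1 r.
  by rewrite /degree !scale0r !addr0 mulmxDl mulmxDr => -> ->.
- by move=> r; rewrite /degree mulmx0 mul0mx scaler0 addr0.
- exists v0 => w; elim: (vT w) => [|c x y _ hx _ hy|r x _ hx].
  + exact: orbit_base.
  + exact: orbit_lin.
  + exact: (orbit_act (inr r) hx).
exists v => w; elim: (vc w) => [|c x y _ hx _ hy|[//|r] x _ hx].
- exact: orbit_base.
- exact: orbit_lin.
by rewrite addr0 addrC; exact: (orbit_act r hx).
Qed.

Lemma image_proj k x : I x -> I ('pi_ k *m x).
Proof.
move=> [z ->]; rewrite mulmxA; case: k => [|k].
  by rewrite (proj0_degree1 HW (degree_raise hT 1)) mul0mx; exact: Is.1.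
by rewrite (proj_degree1 HW k (degree_raise hT 1)) -mulmxA; exists ('pi_ k *m z).
Qed.

(** A functional that vanishes on the image of [e], restricted to weight beta + k, is a highest
    vector of weight M - 2k for the transposed sl_2-triple. Such a weight is a natural number, so 2k
    <= M. *)
Lemma high_weight_image k x : (M < 2 * k)%N -> I ('pi_ k *m x).
Proof.
move=> Mk; apply: contrapT => /image_separation [phi phie phix].
pose psi := (phi *m 'pi_ k)^T.
have psi0 : psi != 0.
  rewrite trmx_eq0; apply: contra_neq phix => phi0.
  by rewrite mulmxA phi0 mul0mx.
have c01 : e *m f - f *m e = H - T 1 1 1%N by rewrite yangian_rel1 //= !scale1r.
have EF : e^T *m f^T - f^T *m e^T = (T 1 1 1%N - H)^T.
  by rewrite -!trmx_mul -linearB /= -opprB c01 opprB.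
have HF : (T 1 1 1%N - H)^T *m f^T - f^T *m (T 1 1 1%N - H)^T = - 2 *: f^T.
  rewrite -!trmx_mul -linearB /= -linearZ /=; congr (_^T).
  rewrite mulmxBl mulmxBr.
  have := degree_lower hT 1; rewrite /degree => ->.
  have : T 1 1 1%N *m f - f *m T 1 1 1%N = f by rewrite yangian_rel1 //= scale1r scale0r subr0.
  move=> /eqP; rewrite subr_eq => /eqP ->; mx_lin.
have epsi : e^T *m psi = 0.
  rewrite -trmx_mul -mulmxA.
  have [Z ->] : exists Z, 'pi_ k *m e = e *m Z; last by rewrite mulmxA phie mul0mx trmx0.
  case: (k) Mk => [//|k' _]; exists ('pi_ k').
  exact: proj_degree1 (degree_raise hT 1).
have Hpsi : (T 1 1 1%N - H)^T *m psi = (M%:R - (2 * k)%:R) *: psi.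
  rewrite -trmx_mul -linearZ /=; congr (_^T).
  have -> : T 1 1 1%N - H = (2 * beta + M%:R)%:M - 2 *: H.
    by rewrite -(lc_trace TL); mx_lin.
  rewrite mulmxBr mul_mx_scalar -scalemxAr -mulmxA (weight_proj_comm HW).
  by rewrite -scalemxAr natrM; mx_lin.
have [p [/eqP]] := sl2_highest_weight EF HF epsi Hpsi psi0.
rewrite subr_eq -natrD eqr_nat => /eqP ME; move: Mk.
by rewrite ME ltnNge leq_addl.
Qed.

Variable q : K.
Hypothesis casimir : tau 2%N + T 1 1 1%N + H *m T 1 1 1%N - f *m e = q%:M.
Let c k : K := q - (beta + k%:R) * (1 + beta + M%:R - k%:R).

(** In tau^(2) = q - H - H t_22^(1) + e f the last term disappears modulo the image of [e], and the
    others are scalar on weight beta + k. *)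
Lemma casimir_proj k x : I (tau 2%N *m ('pi_ k *m x) - c k *: ('pi_ k *m x)).
Proof.
set y := 'pi_ k *m x.
have Hy : H *m y = (beta + k%:R) *: y by rewrite mulmxA (weight_mulr_proj HW) scalemxAl.
have T1y : T 1 1 1%N *m y = (beta + M%:R - k%:R) *: y.
  have -> : T 1 1 1%N = (2 * beta + M%:R)%:M - H by rewrite -(lc_trace TL); mx_lin.
  by rewrite mulmxBl Hy mul_scalar_mx -scalerBl; congr (_ *: _); ring.
have c01 : e *m f - f *m e = H - T 1 1 1%N by rewrite yangian_rel1 //= !scale1r.
have -> : tau 2%N = q%:M - H - H *m T 1 1 1%N + e *m f.
  by rewrite -casimir -[e *m f](subrK (f *m e)) c01; mx_lin.
exists (f *m y); rewrite mulmxDl !mulmxBl -!mulmxA T1y -scalemxAr Hy mul_scalar_mx.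
by rewrite /c; mx_lin.
Qed.

(** On the cokernel [taup 2] is triangular for the weight grading: its diagonal is [c], and t_12^(2)
    carries weight j - 1 to weight j. *)
Lemma twisted_casimir_proj j x : I ('pi_ j *m (taup 2%N *m x) - c j *: ('pi_ j *m x)
  - (if j is j'.+1 then T 0 1 2%N *m ('pi_ j' *m x) else 0)).
Proof.
have := casimir_proj j x.
have d0 : degree H 0 (tau 2%N).
  have := degree_diag hT 0 2; have := degree_diag hT 1 2.
  by rewrite /degree !scale0r !addr0 mulmxDl mulmxDr => -> ->.
rewrite [_ *m (_ *m x)]mulmxA -(proj_degree0 HW _ d0) mulmxDl mulmxDr -!mulmxA.
case: j => [|j].
  rewrite ['pi_ _ *m (T 0 1 _ *m _)]mulmxA (proj0_degree1 HW (degree_raise hT 2)) mul0mx.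
  by rewrite addr0 subr0.
rewrite ['pi_ _ *m (T 0 1 _ *m _)]mulmxA (proj_degree1 HW _ (degree_raise hT 2)) -mulmxA.
by rewrite addrAC addrK.
Qed.

(** * Spectral projections of the deformed Casimir element *)

Let A j := taup 2%N - (c j)%:M.
(** The weight filtration of the cokernel of [e]: components below level k vanish there. *)
Let filt k x := forall j, (j < k)%N -> I ('pi_ j *m x).

Let AE j (x : 'cV_d) : A j *m x = taup 2%N *m x - c j *: x.
Proof. by rewrite mulmxBl mul_scalar_mx. Qed.

Let filt_A k j x : filt k x ->
  filt k (A j *m x) /\ I ('pi_ k *m (A j *m x) - (c k - c j) *: ('pi_ k *m x)).
Proof.
move=> fx.
have key i : (i <= k)%N -> I ('pi_ i *m (A j *m x) - (c i - c j) *: ('pi_ i *m x)).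
  move=> ik; have := twisted_casimir_proj i x.
  have Iprev : I (if i is j'.+1 then T 0 1 2%N *m ('pi_ j' *m x) else 0).
    case: i ik => [|i] ik; first exact: Is.1.
    by apply: image_mod_comm; [exact: raise_comm | exact: fx].
  move=> /(subspaceD Is)/(_ Iprev); rewrite subrK AE mulmxBr -scalemxAr.
  by congr I; mx_lin.
split; last exact: key.
move=> i ik; rewrite -[_ *m _](subrK ((c i - c j) *: ('pi_ i *m x))).
by apply: subspaceD => //; [exact: key (ltnW ik) | apply: subspaceZ => //; exact: fx].
Qed.

Let filt_top x : filt M./2.+1 x -> I x.
Proof.
move=> fx; rewrite -[x]mul1mx -(proj_sum HW) mulmx_suml.
apply: subspace_sum => // k _; have [kM|Mk] := leqP (2 * k) M.
  by apply: fx; rewrite ltnS geq_half_double -mul2n.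
exact: high_weight_image.
Qed.

Let A_comm i j : A i *m A j = A j *m A i.
Proof.
rewrite /A !mulmxBl !mulmxBr !mul_scalar_mx !mul_mx_scalar !scale_scalar_mx.
by rewrite [c j * _]mulrC; mx_lin.
Qed.

Let prod_A_comm (r : seq nat) Z : (forall j, A j *m Z = Z *m A j) ->
  (\prod_(j <- r) A j) *m Z = Z *m \prod_(j <- r) A j.
Proof.
move=> AZ; elim/big_rec: _ => [|j x _ IH]; first by rewrite mul1mx mulmx1.
by rewrite -mulmxE -mulmxA IH !mulmxA AZ.
Qed.

(** Each [A k] moves level k of the filtration to level k + 1, since its diagonal entry there is 0.
    The product thus passes the last level of the cokernel. *)
Let filt_prod n k x : (k + n)%N = M./2.+1 -> filt k x ->
  I ((\prod_(k <= j < M./2.+1) A j) *m x).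
Proof.
elim: n k x => [|n IH] k x kn fx.
  rewrite -kn addn0 big_geq // mul1mx; apply: filt_top.
  by rewrite -kn addn0.
rewrite big_ltn; last by rewrite -kn addnS ltnS leq_addr.
rewrite -mulmxE -prod_A_comm => [|j]; last exact: A_comm.
rewrite -mulmxA; apply: IH; first by rewrite addSnnS.
have [fAx IAx] := filt_A k fx; move: IAx; rewrite subrr scale0r subr0 => IAx j.
by rewrite ltnS leq_eqVlt => /orP [/eqP ->//|]; exact: fAx.
Qed.

(** The difference is (j - i)(M + 1 - i - j), and i + j <= M in the lower half of the weights. *)
Let c_neq i j : (i < M./2.+1)%N -> (j < M./2.+1)%N -> i != j -> c i - c j != 0.
Proof.
rewrite !ltnS !geq_half_double => iM jM ij.
have -> : c i - c j = (j%:R - i%:R) * (M.+1%:R - (i + j)%:R).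
  by rewrite /c natrD -natr1; ring.
rewrite mulf_eq0 !subr_eq0 !eqr_nat eq_sym (negPf ij) /=.
have := leq_add iM jM; rewrite -doubleD addnn leq_double => ijM.
by rewrite gtn_eqF // ltnS.
Qed.

(** By induction on j < k, triangularity leaves (c j - c k) times the component of weight j, and c j
    differs from c k. *)
Let eigen_filt k x : (k < M./2.+1)%N -> I (A k *m x) -> filt k x.
Proof.
move=> kM IAx; elim/ltn_ind => j IH jk.
have Iprev : I (if j is j'.+1 then T 0 1 2%N *m ('pi_ j' *m x) else 0).
  case: j IH jk => [|j] IH jk; first exact: Is.1.
  by apply: image_mod_comm; [exact: raise_comm | apply: IH => //; exact: ltnW].
have := subspaceD Is (twisted_casimir_proj j x) Iprev; rewrite subrK => h.
have := subspaceB Is (image_proj j IAx) h; rewrite AE mulmxBr -scalemxAr => {}h.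
apply: (subspaceZ_inv Is (c_neq (ltn_trans jk kM) kM _)); first by rewrite ltn_eqF.
by move: h; congr I; mx_lin.
Qed.

(** The unnormalized spectral projection of [taup 2] on the cokernel for the eigenvalue [c k];
    [gamma k] below is its normalizing factor. *)
Let Q k := (\prod_(0 <= j < k) A j) *m \prod_(k.+1 <= j < M./2.+1) A j.

Let Q_comm k r : Q k *m taup r = taup r *m Q k.
Proof.
have At j : A j *m taup r = taup r *m A j.
  by rewrite /A mulmxBl mulmxBr mul_scalar_mx mul_mx_scalar twisted_transfer_comm.
by rewrite /Q -mulmxA (prod_A_comm _ At) !mulmxA (prod_A_comm _ At).
Qed.

Let Q_filt k x : (k < M./2.+1)%N -> filt k (Q k *m x).
Proof.
move=> kM; apply: eigen_filt => //.
have -> : A k *m (Q k *m x) = (\prod_(0 <= j < M./2.+1) A j) *m x.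
  rewrite (@big_cat_nat _ _ _ k) //=; last exact: ltnW.
  rewrite (big_ltn kM) -!mulmxE /Q !mulmxA; congr (_ *m _ *m _).
  by rewrite prod_A_comm // => j; exact: A_comm.
by apply: (@filt_prod M./2.+1).
Qed.

Let prod_filt k (r : seq nat) x : filt k x ->
  filt k ((\prod_(j <- r) A j) *m x) /\
  I ('pi_ k *m ((\prod_(j <- r) A j) *m x) - (\prod_(j <- r) (c k - c j)) *: ('pi_ k *m x)).
Proof.
move=> fx; elim: r => [|j r [IHf IHI]].
  by rewrite !big_nil mul1mx scale1r subrr; split=> //; exact: Is.1.
rewrite !big_cons -mulmxE -mulmxA; have [fA IA] := filt_A j IHf; split=> //.
have := subspaceD Is IA (subspaceZ (c k - c j) Is IHI).
by rewrite scalerBr addrA subrK scalerA.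
Qed.

Let gamma k := \prod_(0 <= j < k) (c k - c j) * \prod_(k.+1 <= j < M./2.+1) (c k - c j).

Let gamma_neq0 k : (k < M./2.+1)%N -> gamma k != 0.
Proof.
move=> kM; rewrite /gamma mulf_neq0 // prodf_seq_neq0; apply/allP => j;
  rewrite mem_index_iota /=.
  by move=> jk; apply: c_neq; rewrite ?gtn_eqF // (ltn_trans jk).
by move=> /andP [kj jM]; apply: c_neq; rewrite ?ltn_eqF.
Qed.

(** A vector of weight k lies in level k, where each [A j] acts on the leading component by c k - c
    j. Hence taking leading components maps the eigenspace for [c k] onto the weight space. *)
Let Q_proj k x : I ('pi_ k *m (Q k *m ('pi_ k *m x)) - gamma k *: ('pi_ k *m x)).
Proof.
have fx : filt k ('pi_ k *m x).
  move=> j jk; rewrite mulmxA (proj_idem HW) ltn_eqF // scale0r mul0mx; exact: Is.1.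
have [f1 I1] := prod_filt (index_iota k.+1 M./2.+1) fx.
have [_ I2] := prod_filt (index_iota 0 k) f1.
have := subspaceD Is I2 (subspaceZ (\prod_(0 <= j < k) (c k - c j)) Is I1).
rewrite scalerBr addrA subrK scalerA -/(gamma k) /Q -mulmxA.
by rewrite [X in _ *: X]mulmxA (proj_idem HW) eqxx scale1r.
Qed.

(** On level k the extra term t_12^(r) reaches weight k only from weight k - 1, which is zero in the
    cokernel; so the leading component intertwines [taup r] with [tau r]. *)
Let taup_proj k r y : filt k y -> I ('pi_ k *m (taup r *m y) - tau r *m ('pi_ k *m y)).
Proof.
move=> fy; have d0 : degree H 0 (tau r).
  have := degree_diag hT 0 r; have := degree_diag hT 1 r.
  by rewrite /degree !scale0r !addr0 mulmxDl mulmxDr => -> ->.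
rewrite mulmxDl mulmxDr ['pi_ k *m (tau r *m y)]mulmxA (proj_degree0 HW _ d0) -mulmxA.
rewrite addrC addKr mulmxA; case: k fy => [|k] fy.
  by rewrite (proj0_degree1 HW (degree_raise hT r)) mul0mx; exact: Is.1.
rewrite (proj_degree1 HW _ (degree_raise hT r)) -mulmxA.
by apply: image_mod_comm; [exact: raise_comm | exact: fy].
Qed.

(** [Q k] commutes with [taup r], so x -> ['pi_ k *m (Q k *m x)] intertwines [taup r] with [tau r]
    modulo the image of [e] and carries the orbit of [v] to an orbit under [tau]. *)
Let orbit_proj v k : (k < M./2.+1)%N -> (forall w, orbit_span (fun r => taup r) v w) ->
  forall w, exists2 u, orbit_span (fun r => tau r) ('pi_ k *m (Q k *m v)) u
    & I ('pi_ k *m w - u).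
Proof.
move=> kM vc.
have step w : exists2 u, orbit_span (fun r => tau r) ('pi_ k *m (Q k *m v)) u
    & I ('pi_ k *m (Q k *m w) - u).
  elim: (vc w) => [|a x y _ [u hu Iu] _ [z hz Iz]|r x _ [u hu Iu]].
  - by exists ('pi_ k *m (Q k *m v)); [exact: orbit_base | rewrite subrr; exact: Is.1].
  - exists (a *: u + z); first exact: orbit_lin.
    have := Is.2 a _ _ Iu Iz; rewrite !mulmxDr -!scalemxAr.
    by congr I; mx_lin.
  - exists (tau r *m u); first exact: (orbit_act r hu).
    rewrite [Q k *m _]mulmxA Q_comm -mulmxA.
    have := taup_proj r (Q_filt x kM).
    have := image_mod_comm (trace_raise_comm hT r) Iu; rewrite mulmxBr => h1 h2.
    by have := subspaceD Is h2 h1; rewrite addrA subrK.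
(* Taking ['pi_ k *m w] as input makes [Q_proj] applicable; dividing by [gamma k] then recovers the
   weight component. *)
move=> w; have [u hu Iu] := step ('pi_ k *m w).
exists ((gamma k)^-1 *: u); first by apply: subspaceZ => //; exact: subspace_orbit.
apply: (subspaceZ_inv Is (gamma_neq0 kM)).
rewrite scalerBr scalerA mulfV ?gamma_neq0 // scale1r.
have := subspaceB Is Iu (Q_proj k w); rewrite opprB addrAC addrCA subrr addr0.
exact.
Qed.

Let prod_tau_proj (r : seq nat) (P : pred nat) k x :
  I ((\prod_(j <- r | P j) (tau 2%N - (c j)%:M)) *m ('pi_ k *m x)
     - (\prod_(j <- r | P j) (c k - c j)) *: ('pi_ k *m x)).
Proof.
elim/big_rec2: _ => [|j g B _ IH]; first by rewrite mul1mx scale1r subrr; exact: Is.1.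
rewrite -mulmxE -mulmxA.
have I1 : I ((tau 2%N - (c j)%:M) *m (B *m ('pi_ k *m x) - g *: ('pi_ k *m x))).
  apply: image_mod_comm IH.
  by rewrite mulmxBl mulmxBr trace_raise_comm // mul_scalar_mx mul_mx_scalar.
have := subspaceD Is I1 (subspaceZ g Is (casimir_proj k x)).
rewrite mulmxBr -scalemxAr [(_ - _) *m ('pi_ k *m x)]mulmxBl mul_scalar_mx.
by congr I; mx_lin.
Qed.

(** Each [vk k] generates weight k of the cokernel under [tau]. Polynomials in [tau 2] extract every
    [vk k] from their sum [v], and [nakayama] passes from the cokernel to the whole space. *)
Lemma cyclic_transfer_raise : cyclic (fun x : nat + unit =>
  match x with inl r => tau r | inr _ => e end).
Proof.
have [v' vc] := cyclic_twisted_transfer.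
pose h := M./2.+1; pose vk k := 'pi_ k *m (Q k *m v').
pose v := \sum_(k < h) vk k; exists v.
set X := fun x : nat + unit => _.
have Xs : subspace (orbit_span X v) by exact: subspace_orbit.
pose W y := exists2 u, orbit_span X v u & I (y - u).
have Ws : subspace W.
  split=> [|a x y [u hu Iu] [z hz Iz]].
    by exists 0; [exact: Xs.1 | rewrite subrr; exact: Is.1].
  exists (a *: u + z); first exact: orbit_lin.
  by have := Is.2 a _ _ Iu Iz; congr I; mx_lin.
have Wtau r y : W y -> W (tau r *m y).
  move=> [u hu Iu]; exists (tau r *m u); first exact: (orbit_act (inl r) hu).
  by rewrite -mulmxBr; exact: image_mod_comm (trace_raise_comm hT r) Iu.
(* On the cokernel [B] acts by [g k != 0] on weight k and by 0 on every other weight below [h], so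
   it isolates [vk k] in [v]. *)
have Wvk k : (k < h)%N -> W (vk k).
  move=> kh; pose B := \prod_(0 <= j < h | j != k) (tau 2%N - (c j)%:M).
  pose g i := \prod_(0 <= j < h | j != k) (c i - c j).
  have gk : g k != 0.
    rewrite /g prodf_seq_neq0; apply/allP => j; rewrite mem_index_iota /= => jh.
    by apply/implyP => jk; apply: c_neq; rewrite // eq_sym.
  exists ((g k)^-1 *: (B *m v)).
    apply: subspaceZ => //; rewrite /B; elim/big_rec: _ => [|j Z _ hZ].
      by rewrite mul1mx; exact: orbit_base.
    rewrite -mulmxE -mulmxA mulmxBl mul_scalar_mx; apply: subspaceB => //.
      exact: (orbit_act (inl 2%N) hZ).
    exact: subspaceZ.
  apply: (subspaceZ_inv Is gk); rewrite scalerBr scalerA mulfV // scale1r.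
  have -> : g k *: vk k = \sum_(i < h) g i *: vk i.
    rewrite (bigD1 (Ordinal kh)) //= [X in _ = _ + X]big1 ?addr0 // => i ik.
    rewrite /g big_mkcond (bigD1_seq (i : nat)) ?iota_uniq ?mem_index_iota //=.
    have -> : (i : nat) != k by apply: contra ik => /eqP ik; apply/eqP/val_inj.
    by rewrite subrr mul0r scale0r.
  rewrite /v mulmx_sumr -sumrB; apply: subspace_sum => // i _.
  rewrite -opprB -scaleN1r; apply: subspaceZ => //; exact: prod_tau_proj.
apply: (@nakayama K d _ e) => //.
- apply: (degree1_nilpotent HW); exact: (degree_raise hT 1).
- by move=> w; exact: (orbit_act (inr tt)).
move=> w; rewrite -/(W w) -[w]mul1mx -(proj_sum HW) mulmx_suml.
apply: subspace_sum => // k _; have [kM|Mk] := leqP (2 * k) M; last first.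
  by exists 0; [exact: Xs.1 | rewrite subr0; exact: high_weight_image].
have kh : (k < h)%N by rewrite ltnS geq_half_double -mul2n.
have [u hu Iu] := orbit_proj kh vc w.
have [z hz Iz] : W u by elim: hu => [|a x y _ ? _ ?|r x _ ?]; [exact: Wvk | exact: Ws.2 | exact: Wtau].
by exists z => //; have := subspaceD Is Iu Iz; rewrite addrA subrK.
Qed.
End TransferAlgebra.

(** * Bethe subalgebras *)

Section TransferMatrices.
Variables (K : numFieldType) (d : nat) (T : 'I_2 -> 'I_2 -> nat -> 'M[K]_d).
Hypothesis hT : yangian_rel T.
Variables (N : nat) (chi : K -> K) (beta : K) (M : nat).
Hypothesis TL : lowest_cyclic T N chi beta M.

Definition transfer (C : 'M[K]_2) (r : nat) : 'M[K]_d :=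
  C 0 0 *: T 0 0 r + C 0 1 *: T 1 0 r + C 1 0 *: T 0 1 r + C 1 1 *: T 1 1 r.

Let degree_diagonal (C : 'M[K]_2) r : degree (T 0 0 1%N) 0 (C 0 0 *: T 0 0 r + C 1 1 *: T 1 1 r).
Proof.
have := degree_diag hT 0 r; have := degree_diag hT 1 r.
rewrite /degree !scale0r !addr0 mulmxDl mulmxDr -!scalemxAl -!scalemxAr.
by move=> -> ->.
Qed.

Let degreeZ c a (Z : 'M[K]_d) : degree (T 0 0 1%N) c Z -> degree (T 0 0 1%N) c (a *: Z).
Proof.
by rewrite /degree -scalemxAl -scalemxAr => ->; rewrite scalerDr !scalerA mulrC.
Qed.

Let transferE C r : transfer C r =
  C 1 0 *: T 0 1 r + (C 0 0 *: T 0 0 r + C 1 1 *: T 1 1 r) + C 0 1 *: T 1 0 r.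
Proof. by rewrite /transfer; mx_lin. Qed.

Lemma transfer_cyclic_lower (C : 'M[K]_2) : C 1 0 != 0 -> cyclic (transfer C).
Proof.
move=> c0; have [v0 _ vT] := lc_cyclic TL.
have [||||| v vc] := @torus_cyclic K d (T 0 0 1%N) beta M (lc_weights TL) void nat (fun _ => 0)
  (fun r => C 1 0 *: T 0 1 r) (fun r => C 0 0 *: T 0 0 r + C 1 1 *: T 1 1 r)
  (fun r => C 0 1 *: T 1 0 r).
- by [].
- by move=> r; apply: degreeZ; exact: degree_raise.
- by move=> r; exact: degree_diagonal.
- by move=> r; apply: degreeZ; exact: degree_lower.
- exists v0 => w; elim: (vT w) => [|c x y _ hx _ hy|r x _ hx].
  + exact: orbit_base.
  + exact: orbit_lin.
  + apply: (subspaceZ_inv _ c0); first exact: subspace_orbit.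
    by rewrite scalemxAl; exact: (orbit_act (inr r) hx).
exists v => w; elim: (vc w) => [|c x y _ hx _ hy|[//|r] x _ hx].
- exact: orbit_base.
- exact: orbit_lin.
by rewrite -transferE; exact: (orbit_act r hx).
Qed.

(** The torus fixes the coefficients of tr T(u) and degenerates the direction to c_21 e, the case of
    [cyclic_transfer_raise]. *)
Lemma transfer_direction_cyclic_lower (C : 'M[K]_2) : C 1 0 != 0 ->
  cyclic (fun x : nat + unit =>
    match x with inl r => transfer 1%:M r | inr _ => transfer C 1 end).
Proof.
move=> c0; have tau_E r : transfer 1%:M r = T 0 0 r + T 1 1 r.
  by rewrite /transfer !mxE /=; mx_lin.
have [q casimir] := lc_casimir TL.
have [v0 vT] := cyclic_transfer_raise hT TL casimir.
have [||||| v vc] := @torus_cyclic K d (T 0 0 1%N) beta M (lc_weights TL) nat unit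
  (transfer 1%:M) (fun=> C 1 0 *: T 0 1 1%N)
  (fun=> C 0 0 *: T 0 0 1%N + C 1 1 *: T 1 1 1%N) (fun=> C 0 1 *: T 1 0 1%N).
- move=> r; have := degree_diagonal 1%:M r.
  by rewrite tau_E !mxE !scale1r.
- by move=> r; apply: degreeZ; exact: degree_raise.
- by move=> r; exact: degree_diagonal.
- by move=> r; apply: degreeZ; exact: degree_lower.
- exists v0 => w; elim: (vT w) => [|c x y _ hx _ hy|[r|[]] x _ hx].
  + exact: orbit_base.
  + exact: orbit_lin.
  + by rewrite -tau_E; exact: (orbit_act (inl r) hx).
  + apply: (subspaceZ_inv _ c0); first exact: subspace_orbit.
    by rewrite scalemxAl; exact: (orbit_act (inr tt) hx).
exists v => w; elim: (vc w) => [|c x y _ hx _ hy|[r|[]] x _ hx].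
- exact: orbit_base.
- exact: orbit_lin.
- exact: (orbit_act (inl r) hx).
- by rewrite -transferE; exact: (orbit_act (inr tt) hx).
Qed.

(* The conjugate g C g^-1, where g is the lower unitriangular matrix with entry x. *)
Definition shear (x : K) (C : 'M[K]_2) : 'M[K]_2 := \matrix_(i, j)
  if i == 0 then (if j == 0 then C 0 0 - x * C 0 1 else C 0 1)
  else (if j == 0 then C 1 0 + x * (C 0 0 - C 1 1) - x ^+ 2 * C 0 1
        else C 1 1 + x * C 0 1).

(** Conjugating by exp(x e) conjugates T(u) by a constant unitriangular matrix, which the trace
    moves over to C. *)
Lemma shear_transfer x : exists2 G : 'M[K]_d,
  forall w : 'cV_d, exists z, w = G *m z &
  forall C r, G *m transfer (shear x C) r = transfer C r *m G.
Proof.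
have [G Gsurj Gconj] := exponential_conjugation x
  (degree1_nilpotent (lc_weights TL) (degree_raise hT 1)).
exists G => // C r.
have br i j : T 0 1 1%N *m T i j r = T i j r *m T 0 1 1%N
    + ((i == 1)%:R *: T 0 j r - (0 == j)%:R *: T i 1 r).
  by rewrite -yangian_rel1 // addrC subrK.
have G00 : G *m T 0 0 r = (T 0 0 r - x *: T 0 1 r) *m G.
  rewrite (Gconj _ (- T 0 1 r) 0) ?scalerN ?scaler0 ?addr0 //.
  - by rewrite br /= scale0r sub0r scale1r.
  - by rewrite mulmxN mulNmx raise_comm.
  - by rewrite mulmx0 mul0mx.
have G11 : G *m T 1 1 r = (T 1 1 r + x *: T 0 1 r) *m G.
  rewrite (Gconj _ (T 0 1 r) 0) ?scaler0 ?addr0 //.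
  - by rewrite br /= scale0r subr0 scale1r.
  - by rewrite raise_comm.
  - by rewrite mulmx0 mul0mx.
have G01 : G *m T 0 1 r = T 0 1 r *m G.
  by rewrite (Gconj _ 0 0) ?scaler0 ?addr0 ?raise_comm ?mulmx0 ?mul0mx.
have G10 : G *m T 1 0 r = (T 1 0 r + x *: (T 0 0 r - T 1 1 r) - x ^+ 2 *: T 0 1 r) *m G.
  rewrite (Gconj _ (T 0 0 r - T 1 1 r) (- 2 *: T 0 1 r)).
  - by congr (_ *m _); apply/matrixP => ? ?; rewrite !mx_linE; field.
  - by rewrite br /= !scale1r.
  - by rewrite mulmxBr mulmxBl !br /=; mx_lin.
  - by rewrite -scalemxAr -scalemxAl raise_comm.
rewrite /transfer !mxE /= !mulmxDr !mulmxDl -!scalemxAr G00 G11 G01 G10.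
by rewrite !mulmxDl ?mulNmx -?scalemxAl !mulmxDl ?mulNmx -?scalemxAl; mx_lin.
Qed.

(** The lower left entry of [shear x C] is a quadratic polynomial in x; its values at 0, 1 and -1
    determine its coefficients, all of which vanish only for scalar C. *)
Lemma shear_nonscalar C : ~~ is_scalar_mx C -> exists x, shear x C 1 0 != 0.
Proof.
apply: contraNP => /forallNP h.
have sh x : C 1 0 + x * (C 0 0 - C 1 1) - x ^+ 2 * C 0 1 = 0.
  by have /negP := h x; rewrite negbK mxE => /eqP.
have h0 := sh 0; have h1 := sh 1; have hm := sh (-1).
have C10 : C 1 0 = 0 by move: h0; rewrite mul0r expr0n /= mul0r addr0 subr0.
have C01 : C 0 1 = 0.
  have : 2 * C 0 1 = 2 * C 1 0 - ((C 1 0 + 1 * (C 0 0 - C 1 1) - 1 ^+ 2 * C 0 1)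
    + (C 1 0 + (-1) * (C 0 0 - C 1 1) - (-1) ^+ 2 * C 0 1)) by ring.
  rewrite h1 hm C10 mulr0 addr0 subr0 => /eqP.
  by rewrite mulf_eq0 pnatr_eq0 => /eqP.
have C11 : C 1 1 = C 0 0.
  apply/esym/eqP; rewrite -subr_eq0; apply/eqP.
  by move: h1; rewrite C10 C01 mulr0 subr0 add0r mul1r.
apply/is_scalar_mxP; exists (C 0 0); apply/matrixP => i j.
by case: (I2P i) (I2P j) => -> [] ->; rewrite mxE /= ?C10 ?C01 ?C11.
Qed.

Lemma transfer_cyclic C : ~~ is_scalar_mx C -> cyclic (transfer C).
Proof.
move=> /shear_nonscalar [x] /transfer_cyclic_lower cyc.
have [G Gs GC] := shear_transfer x.
apply: cyclic_transport Gs _ cyc => r; exists 1.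
by rewrite scale1r; exact: GC.
Qed.

Lemma transfer_direction_cyclic C : ~~ is_scalar_mx C ->
  cyclic (fun x : nat + unit =>
    match x with inl r => transfer 1%:M r | inr _ => transfer C 1 end).
Proof.
move=> /shear_nonscalar [x] /transfer_direction_cyclic_lower cyc.
have [G Gs GC] := shear_transfer x.
have s1 : shear x 1%:M = 1%:M.
  by apply/matrixP => i j; case: (I2P i) (I2P j) => -> [] ->; rewrite !mxE /=; ring.
apply: cyclic_transport Gs _ cyc => -[r|_]; exists 1; rewrite scale1r -GC //.
by rewrite s1.
Qed.
End TransferMatrices.

(** * Tensor products of evaluation modules *)

Section Modules.
Variable K : numFieldType.

Definition gen_action (M : ymodule K) i j r := yact M (ygen K i j r).

Lemma gen_action_rel M : yangian_rel (gen_action M).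
Proof.
have [h0 h] := ygen_rel K; split=> [i j|i j k l r s].
  by rewrite /gen_action h0 rmorph_nat.
by rewrite /gen_action -!rmorphM -!rmorphB /= h.
Qed.

Lemma gen_action0 M i j : gen_action M i j 0 = (i == j)%:R%:M.
Proof. by rewrite (gen_action_rel M).1 rmorph_nat. Qed.

Lemma gen_action_ev (V : gl2module K) i j r :
  gen_action (ev_module V) i j r = ev_op V i j r.
Proof. exact: yeval_gen. Qed.

(** On an evaluation module t^(p) is zero for p >= 2, so only p = 0 and p = 1 survive in the
    coproduct. *)
Lemma gen_action_tens (V : gl2module K) (M : ymodule K) i j r :
  gen_action (tens_module (ev_module V) M) i j r.+1 =
  1%:M *t gen_action M i j r.+1
  + (gE V i 0 *t gen_action M 0 j r + gE V i 1 *t gen_action M 1 j r).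
Proof.
transitivity (\sum_(k < 2) \sum_(p < r.+2)
  gen_action (ev_module V) i k p *t gen_action M k j (r.+1 - p)).
  exact: yeval_gen.
have inner k : \sum_(p < r.+2) gen_action (ev_module V) i k p *t gen_action M k j (r.+1 - p)
    = (i == k)%:R%:M *t gen_action M k j r.+1 + gE V i k *t gen_action M k j r.
  rewrite !big_ord_recl big1 => [|p _]; last by rewrite gen_action_ev /= tens0mx.
  by rewrite /bump /= addr0 subn0 subSS subn0 gen_action0 gen_action_ev.
under eq_bigr do rewrite inner.
rewrite !big_ord_recl big_ord0 addr0.
have -> : lift ord0 ord0 = 1 :> 'I_2 by apply/val_inj.
by case: (I2P i) => -> /=; rewrite rmorph0 rmorph1 tens0mx; mx_lin.
Qed.

(** The control on the zeros of [chi], which can only be the -a_i, is carried through the induction: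
    it makes [chi] of the later factors nonzero at -(b_0 + q). *)
Lemma tens_family_lowest_cyclic n (b : 'I_n.+1 -> K) (m : 'I_n.+1 -> nat)
    (V : 'I_n.+1 -> gl2module K) :
  (forall i, exists l, lowest_string (gE (V i)) (b i) (m i) l) ->
  (forall i j : 'I_n.+1, (i < j)%N -> forall q, (q < m i)%N -> b j + (m j)%:R != b i + q%:R) ->
  exists N chi beta M,
    lowest_cyclic (gen_action (tens_family (fun i => ev_module (V i)))) N chi beta M
    /\ forall u, (forall i, u + (b i + (m i)%:R) != 0) -> chi u != 0.
Proof.
elim: n b m V => [|n IH] b m V lV hb; have [l0 l0V] := lV ord0.
  exists 1%N, (fun u => u + (b ord0 + (m ord0)%:R)), (b ord0), (m ord0); split; last first.
    by move=> u; exact.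
  apply: (@string_lowest_cyclic _ _ _ _ _ l0) => [i j|i j r|].
  - exact: (gen_action0 (ev_module (V ord0)) i j).
  - exact: gen_action_ev.
  - have -> : (fun i j => gen_action (ev_module (V ord0)) i j 1) = gE (V ord0).
      by apply/funext => i; apply/funext => j; exact: gen_action_ev.
    exact: l0V.
have [|i j ij q|N [chi [beta [M [TL chi0]]]]] :=
    IH (b \o lift ord0) (m \o lift ord0) (fun i => V (lift ord0 i)).
- by move=> i; exact: lV.
- by apply: hb.
exists N.+1, (fun u => (u + (b ord0 + (m ord0)%:R)) * chi u), (b ord0 + beta), (m ord0 + M)%N.
split; last first.
  move=> u hu; rewrite mulf_neq0 ?hu //; apply: chi0 => i; exact: hu.
apply: (tensor_lowest_cyclic l0V _ _ _ TL) => [i j|i j|i j r|q qm].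
- exact: gen_action0.
- exact: (gen_action0 (tens_family (fun i => ev_module (V i)))).
- exact: (gen_action_tens (V ord0) (tens_family (fun i => ev_module (V (lift ord0 i))))).
apply: chi0 => i; rewrite addrC subr_eq0; exact: hb.
Qed.

Lemma subalg_subalg_closed (S : set (yangian K)) : GRing.subalg_closed (mem (subalg S)).
Proof.
split.
- by apply/mem_set => A [[A1 _ _] _]; apply/set_mem.
- move=> c x y /set_mem hx /set_mem hy; apply/mem_set => A AS; apply/set_mem.
  have [[_ Al _] _] := AS; apply: Al; apply/mem_set; [exact: hx | exact: hy].
- move=> x y /set_mem hx /set_mem hy; apply/mem_set => A AS; apply/set_mem.
  have [[_ _ AM] _] := AS; apply: AM; apply/mem_set; [exact: hx | exact: hy].
Qed.

Lemma cyclic_has_cyclic_vector (S : set (yangian K)) (M : ymodule K) (J : Type)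
    (Y : J -> yangian K) :
  (forall j, subalg S (Y j)) -> cyclic (fun j => yact M (Y j)) ->
  has_cyclic_vector (subalg S) M.
Proof.
have [S1 Sl SM] := subalg_subalg_closed S.
move=> SY [v vY]; exists v; apply/seteqP; split=> // w _.
elim: (vY w) => [|c _ _ _ [x Sx <-] _ [y Sy <-]|j _ _ [x Sx <-]].
- by exists 1; [exact/set_mem | rewrite rmorph1 mul1mx].
- exists (c *: x + y); first by apply/set_mem/Sl; exact/mem_set.
  by rewrite linearP mulmxDl scalemxAl.
- exists (Y j * x); first by apply/set_mem/SM; exact/mem_set.
  by rewrite rmorphM /= -mulmxE mulmxA.
Qed.

Lemma subalg_gen (S : set (yangian K)) x : S x -> subalg S x.
Proof. by move=> Sx A [_]; exact. Qed.
End Modules.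

(** * Strings in general position *)

Lemma string_setE (K : numFieldType) (b z : K) m :
  string_set (b + m%:R) b z <-> exists2 k, (k < m)%N & z = b + k%:R.
Proof.
split=> [[k [l [-> /eqP]]]|[k km ->]].
  rewrite -subr_eq0 => /eqP h; exists k => //.
  have /eqP : (k + l.+1)%:R = m%:R :> K.
    by rewrite natrD -natr1; apply/eqP; rewrite -subr_eq0 -[X in _ == X]h; apply/eqP; ring.
  by rewrite eqr_nat => /eqP <-; rewrite addnS ltnS leq_addr.
exists k, (m - k.+1)%N; split=> //.
by rewrite natrB // -natr1; ring.
Qed.

(** With a = b + m and a' = b' + m' = b + q, the second string begins directly below b + q. The
    union is S(a, b) if m' <= q, and S(a, b') otherwise. *)
Lemma string_union_is_string (K : numFieldType) (b b' : K) (m m' q : nat) :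
  (q < m)%N -> b' + m'%:R = b + q%:R ->
  is_string (string_set (b + m%:R) b `|` string_set (b' + m'%:R) b').
Proof.
move=> qm bE; have b'E : b' = b + q%:R - m'%:R by rewrite -bE addrK.
have [m'q|qm'] := leqP m' q.
  exists (b + m%:R), b; split.
    by exists m.-1; rewrite addrC addKr prednK // (leq_trans _ qm).
  apply/seteqP; split=> z; last by left.
  move=> [//|/string_setE [k km' ->]]; apply/string_setE.
  exists (q - m' + k)%N; last by rewrite b'E natrD natrB //; ring.
  by rewrite (leq_trans _ (ltnW qm)) // -{2}(subnK m'q) ltn_add2l.
have bE' : b = b' + (m' - q)%:R by rewrite natrB ?(ltnW qm') // b'E; ring.
have mE : b + m%:R = b' + (m' - q + m)%:R by rewrite natrD addrA -bE'.
exists (b + m%:R), b'; split.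
  exists (m' - q + m).-1; rewrite mE addrC addKr prednK //.
  by rewrite addn_gt0 subn_gt0 qm'.
rewrite mE; apply/seteqP; split=> z.
  rewrite -{1}mE => -[/string_setE [k km ->]|/string_setE [k km' ->]]; apply/string_setE.
    exists (m' - q + k)%N; first by rewrite ltn_add2l.
    by rewrite natrD addrA -bE'.
  exists k => //; apply: (leq_trans km').
  by rewrite -{1}(subnK (ltnW qm')) leq_add2l ltnW.
move=> /string_setE [k km ->]; have [kmq|mqk] := ltnP k (m' - q).
  right; apply/string_setE; exists k => //.
  exact: leq_trans kmq (leq_subr _ _).
left; rewrite -mE; apply/string_setE; exists (k - (m' - q))%N.
  by rewrite ltn_subLR.
by rewrite natrB // bE'; ring.
Qed.

Theorem theorem2 (R : realType) (n : nat) (a b : 'I_n.+1 -> R[i])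
  (V : 'I_n.+1 -> gl2module R[i])
  (hab : forall i, pos_int (a i - b i))
  (hV : forall i, is_L (V i) (a i) (b i))
  (hstr : forall i j : 'I_n.+1, (i < j)%N ->
     ~ is_string (string_set (a i) (b i) `|` string_set (a j) (b j)))
  (x : blowup R[i]) :
  has_cyclic_vector (bethe_family x)
    (tens_family (fun i => ev_module (V i))).
Proof.
have [m mP] := choice (fun i => L_lowest_string (hV i)).
have aE i : a i = b i + (m i)%:R by have [l []] := mP i.
have lV i : exists l, lowest_string (gE (V i)) (b i) (m i) l.
  by have [l []] := mP i; exists l.
(* If a_j belonged to S(a_i, b_i), the union of the two strings would be a string. *)
have hb (i j : 'I_n.+1) : (i < j)%N -> forall q, (q < m i)%N -> b j + (m j)%:R != b i + q%:R.
  move=> ij q qm; apply: contra_notN (hstr i j ij) => /eqP bE.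
  by rewrite !aE; exact: string_union_is_string qm bE.
have [N [chi [beta [M [TL _]]]]] := tens_family_lowest_cyclic lV hb.
set F := tens_family _ in TL *.
have hT := gen_action_rel F.
have trE C r : yact F (trT C r) = transfer (gen_action F) C r.
  by rewrite /trT !linearD !linearZ.
rewrite /bethe_family; case: ifPn => [_|nscal]; last first.
  apply: (@cyclic_has_cyclic_vector _ _ _ _ (trT (bl_mx x))) => [r|].
    by apply: subalg_gen; right; exists r.
  have -> : (fun r => yact F (trT (bl_mx x) r)) = transfer (gen_action F) (bl_mx x).
    by apply/funext => r; exact: trE.
  exact: (transfer_cyclic hT TL).
pose y := bl_dir x.
(* The traceless matrix with coordinates [y]: the direction element is the u^-1 coefficient of tr C
   T(u). *)
pose C : 'M[R[i]]_2 := \matrix_(i, j)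
  if i == 0 then (if j == 0 then 2^-1 * y 0 0 else y 0 1)
  else (if j == 0 then y 0 2 else - (2^-1 * y 0 0)).
apply: (@cyclic_has_cyclic_vector _ _ _ _ (fun z : nat + unit =>
  match z with inl r => trT 1%:M r | inr _ => dir_elt y end)) => [[r|_]|].
- by apply: subalg_gen; left; apply: subalg_gen; right; exists r.
- by apply: subalg_gen; right.
have -> : (fun z : nat + unit => yact F (match z with inl r => trT 1%:M r
    | inr _ => dir_elt y end)) = (fun z : nat + unit => match z with
    inl r => transfer (gen_action F) 1%:M r | inr _ => transfer (gen_action F) C 1 end).
  apply/funext => -[r|_]; first exact: trE.
  rewrite -trE; congr (yact F _).
  by rewrite /trT /dir_elt !mxE /= scaleNr.
apply: (transfer_direction_cyclic hT TL).
(* A traceless scalar matrix is zero, which would make all coordinates of [y] vanish. *)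
apply: contra (bl_dir_neq0 x) => /is_scalar_mxP [c CE].
have ent i j : C i j = c *+ (i == j) by rewrite CE mxE.
have := ent 0 0; have := ent 1 1; have := ent 0 1; have := ent 1 0.
rewrite !mxE /= !mulr0n !mulr1n => y2 y1 y3 y0.
have y00 : y 0 0 = 0.
  have -> : y 0 0 = 2^-1 * y 0 0 + 2^-1 * y 0 0 by field.
  by rewrite {1}y0 -y3 addNr.
apply/eqP/rowP => j; rewrite mxE.
case: j => [[|[|[|//]]]] ?.
- by rewrite -y00; congr (y 0 _); apply/val_inj.
- by rewrite -y1; congr (y 0 _); apply/val_inj.
- by rewrite -y2; congr (y 0 _); apply/val_inj.
Qed.
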